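(* In the setting of the context, let $\delta(u;v)\in\Delta_U$. Every regular Borel probability measure $\mu$ on $S_\delta(E)$ has a unique $\delta$-barycenter $b_\mu^\delta\in\operatorname{Def}_E(v)$. If $r_\delta:S_1(E)\to S_\delta(E)$ is restriction, then the barycenter of a complete measure $\rho$ (a regular Borel probability measure on $S_1(E)$) depends only on $(r_\delta)_*\rho$. In particular, complete lifts of the same local measure have the same barycenter.
   Context: $(X,\tau)$ is a nonempty, locally compact, locally connected Hausdorff space with a sheaf $H$ of continuous real functions (harmonic functions, $H(U)$ a linear space) forming a Brelot harmonic space: there is a base $\tau_0$ of relatively compact regular open sets (regular: every $g\in C(\partial U)$ has a unique harmonic extension with boundary values $g$, nonnegative if $g\ge0$), and increasing sequences of harmonic functions on a connected $U\in\tau_0$ have supremum harmonic or $\equiv+\infty$. $\mathcal L_{\mathrm{Har}}$ is the many-sorted continuous language with a metric point sort $X$ and, for $U\in\tau_0$, metric sorts for $U$, $H(U)$ and boundary functions, with symbols for inclusions, restrictions, the Dirichlet operator and the evaluation $\operatorname{Eval}_U(x,h)=h(x)$. Fix a regular Greenian domain $U\in\tau_0$, $x_0\in U$, a dense $A\subseteq U$, $Ax_0=A\cup\{x_0\}$. $H_1^+(U,x_0)$ is the set of nonnegative harmonic $h$ on $U$ with $h(x_0)=1$. $U$ has a countable compact exhaustion $C_0\Subset C_1\Subset\cdots$ with $x_0\in C_0$; $c_n\ge1$ is such that $h(x)\le c_nh(x_0)$ for $x\in C_n$ and positive harmonic $h$; $\theta_n(h;x)=h(x)/c_n$ for $h\in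 H_1^+(U,x_0)$, $x\in C_n$. $\mathcal L_{\mathrm{Har}}(U,x_0)$ expands the $Ax_0$-definitional expansion of $\mathcal L_{\mathrm{Har}}$ by naming the $C_n$ as metric sorts and the predicates $\theta_n$. $Y_U=\{*\}\sqcup\bigsqcup_{n<\omega}(\{n\}\times C_n)$ is the one-point compactification of the topological sum of the $\{n\}\times C_n$, with inclusions $\iota_n:C_n\to Y_U$. $\mathcal L_{\mathrm{gl}}$ extends $\mathcal L_{\mathrm{Har}}(U,x_0)$ by naming $Y_U$, $*$, the $\iota_n$, and a predicate $\Theta_U$ with $\Theta_U(h;* )=0$, $\Theta_U(h;\iota_n(x))=2^{-n}\theta_n(h;x)$. Fix a countable collection $\mathcal C_0$ of rational piecewise-linear continuous connectives containing $\min$, $\max$, rational scalar multiplication with truncation, and uniformly dense in all finitary continuous connectives. $\Delta_U$ is the set of formulas obtained from $\Theta_U$ by finitely many applications of connectives from $\mathcal C_0$, variable renaming, interchange of object and parameter variables, and pullback along the maps $\iota_n$. Every formula in $\Delta_U$ is stable in the complete theory of the $\mathcal L_{\mathrm{gl}}$-structure (it has no order property: no $\varepsilon>0$, $r$, $(a_i),(b_i)$ with $\delta(a_i;b_j)\le r$, $\delta(a_j;b_i)\ge r+\varepsilon$ for all $i<j$). $E=\operatorname{acl}^{\mathrm{eq}}(Ax_0)$ (imaginaries with compact orbit over $Ax_0$). $S_\delta(E)$ is the space of complete $\delta$-types over $E$ with the logic topology, $S_1(E)$ the space of complete types over $E$ in the object variable. For $p\in S_\delta(E)$, $d_p\delta(v)$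 is its good definition: the $E$-definable predicate such that, over every larger parameter set, $\delta(x;b)=d_p\delta(b)$ prescribes a consistent complete $\delta$-type extending $p$ (it exists and is unique by stability). $\operatorname{Def}_E(v)$ is the space of $E$-definable predicates in $v$ with the uniform norm (closed under finite convex combinations and uniform limits). A $\delta$-barycenter of a regular Borel probability measure $\mu$ on $S_\delta(E)$ is an $E$-definable predicate $b_\mu^\delta\in\operatorname{Def}_E(v)$ with $b_\mu^\delta(v)=\int d_p\delta(v)\,\mathrm d\mu(p)$ at every parameter $v$. The barycenter of a complete measure $\rho$ on $S_1(E)$ is $b^\delta_{(r_\delta)_*\rho}$; a complete lift of a local measure $\mu$ on $S_\delta(E)$ is a $\rho$ with $(r_\delta)_*\rho=\mu$. *)

(* Defs.v *)
From HB Require Import structures.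
From mathcomp Require Import all_boot all_order all_algebra.
From mathcomp Require Import all_classical all_reals all_analysis.
From mathcomp Require Import lra.

Set Implicit Arguments.
Unset Strict Implicit.
Unset Printing Implicit Defensive.

Import Order.TTheory GRing.Theory Num.Theory numFieldNormedType.Exports.
Local Open Scope classical_set_scope.
Local Open Scope ring_scope.

(* A context is a finite tuple of sorted variables; it also serves as the arity
   of a symbol. *)
Record ctx (S : Type) := Ctx { cvar : finType; csort : cvar -> S }.

Definition cnil (S : Type) : ctx S := Ctx (fun i : void => match i with end).
Definition c1 (S : Type) (s : S) : ctx S := Ctx (fun _ : unit => s).
Definition c2 (S : Type) (s t : S) : ctx S :=
  Ctx (fun b : bool => if b then s else t).
Definition cext (S : Type) (G : ctx S) (s : S) : ctx S :=
  Ctx (fun i : option (cvar G) => if i is Some j then csort j else s).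
Definition ccat (S : Type) (G G' : ctx S) : ctx S :=
  Ctx (fun i : cvar G + cvar G' =>
         match i with inl j => csort j | inr j => csort j end).
Definition cmap (S T : Type) (f : S -> T) (G : ctx S) : ctx T :=
  Ctx (fun i : cvar G => f (csort i)).

Record signature := Signature {
  Sort : Type;
  fsym : Type;
  farity : fsym -> ctx Sort;
  fcod : fsym -> Sort;
  psym : Type;
  parity : psym -> ctx Sort }.

Section Syntax.
Variable R : realType.

Definition cube (n : nat) : set 'rV[R]_n := [set x | forall i, 0 <= x 0 i <= 1].

Record connective (n : nat) := Connective {
  capp :> 'rV[R]_n -> R;
  capp_cont : {within cube (n := n), continuous capp};
  capp01 : forall x, cube x -> 0 <= capp x <= 1 }.

Variable L : signature.

Inductive term (G : ctx (Sort L)) : Sort L -> Type :=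
| Var (i : cvar G) : term G (csort i)
| App (f : fsym L) (t : forall i : cvar (farity f), term G (csort i)) :
    term G (fcod f).

Inductive formula : ctx (Sort L) -> Type :=
| FPred G (P : psym L) (t : forall i : cvar (parity P), term G (csort i)) :
    formula G
| FDist G s (t u : term G s) : formula G
| FConn G n (c : connective n) (phi : 'I_n -> formula G) : formula G
| FSup G s (phi : formula (cext G s)) : formula G
| FInf G s (phi : formula (cext G s)) : formula G.

Definition tsubstitution (G G' : ctx (Sort L)) :=
  forall i : cvar G, term G' (csort i).

Fixpoint tsubst G G' (sg : tsubstitution G G') s (t : term G s) : term G' s :=
  match t with
  | Var i => sg i
  | App f u => App (fun i => tsubst sg (u i))
  end.

Definition sext G G' (sg : tsubstitution G G') s :
    tsubstitution (cext G s) (cext G' s) :=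
  fun i => match i with
  | Some j => tsubst (fun k => Var (G := cext G' s) (Some k)) (sg j)
  | None => Var (G := cext G' s) None
  end.

Fixpoint fsubst G (phi : formula G) :
    forall G', tsubstitution G G' -> formula G' :=
  match phi with
  | FPred _ P t => fun _ sg => FPred (fun i => tsubst sg (t i))
  | FDist _ s t u => fun _ sg => FDist (tsubst sg t) (tsubst sg u)
  | FConn _ n c psi => fun _ sg => FConn c (fun i => fsubst (psi i) sg)
  | FSup _ s psi => fun _ sg => FSup (fsubst psi (sext sg (s := s)))
  | FInf _ s psi => fun _ sg => FInf (fsubst psi (sext sg (s := s)))
  end.

Definition scat G H G' H' (sg : tsubstitution G G') (th : tsubstitution H H') :
    tsubstitution (ccat G H) (ccat G' H') :=
  fun i => match i with
  | inl j => tsubst (fun k => Var (G := ccat G' H') (inl k)) (sg j)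
  | inr j => tsubst (fun k => Var (G := ccat G' H') (inr k)) (th j)
  end.

Definition sswap G H : tsubstitution (ccat G H) (ccat H G) :=
  fun i => match i with
  | inl j => Var (G := ccat H G) (inr j)
  | inr j => Var (G := ccat H G) (inl j)
  end.

End Syntax.
Arguments Var {L G}.
Arguments sswap {L G H}.

(* Prestructures: the distances are pseudometrics and need not be complete.  No
   modulus of continuity is attached to a symbol: evaluation on an unbounded
   sort of functions has none.  A modulus valid in a structure is expressible by
   sentences, hence valid in its elementary extensions. *)
Record structure (R : realType) (L : signature) := Structure {
  car :> Sort L -> Type;
  dist : forall s, car s -> car s -> R;
  dist01 : forall s (a b : car s), 0 <= dist a b <= 1;
  dist_refl : forall s (a : car s), dist a a = 0;
  dist_sym : forall s (a b : car s), dist a b = dist b a;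
  dist_tri : forall s (a b c : car s), dist a c <= dist a b + dist b c;
  fint : forall f : fsym L,
    (forall i : cvar (farity f), car (csort i)) -> car (fcod f);
  pint : forall P : psym L, (forall i : cvar (parity P), car (csort i)) -> R;
  pint01 : forall P a, 0 <= @pint P a <= 1 }.

Section Semantics.
Variables (R : realType) (L : signature).
Implicit Types M N : structure R L.

Definition env M (G : ctx (Sort L)) := forall i : cvar G, M (csort i).

Definition eext M G s (rho : env M G) (a : M s) : env M (cext G s) :=
  fun i => match i with Some j => rho j | None => a end.

Definition ecat M G G' (a : env M G) (b : env M G') : env M (ccat G G') :=
  fun i => match i with inl j => a j | inr j => b j end.

Fixpoint teval M G (rho : env M G) s (t : term G s) : M s :=
  match t with
  | Var i => rho i
  | App f u => fint (fun i => teval rho (u i))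
  end.

Fixpoint feval M G (phi : formula R G) : env M G -> R :=
  match phi with
  | FPred _ P t => fun rho => pint (fun i => teval rho (t i))
  | FDist _ s t u => fun rho => dist (teval rho t) (teval rho u)
  | FConn _ n c psi => fun rho => c (\row_i feval (psi i) rho)
  | FSup _ s psi => fun rho => sup (range (fun a => feval psi (eext rho a)))
  | FInf _ s psi => fun rho => inf (range (fun a => feval psi (eext rho a)))
  end.

Record elemext M N := ElemExt {
  emb : forall s, M s -> N s;
  emb_elem : forall G (phi : formula R G) (rho : env M G),
    feval phi (fun i => emb (rho i) : N _) = feval phi rho }.

Definition elemext_id M : elemext M M :=
  @ElemExt M M (fun _ a => a) (fun _ _ _ => erefl).

Definition paramset M := forall s, set (M s).

Record pformula M (A : paramset M) (G : ctx (Sort L)) := PFormula {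
  pctx : ctx (Sort L);
  pfor : formula R (ccat G pctx);
  ppar : env M pctx;
  pparA : forall i, A _ (ppar i) }.

Definition pfeval M N (j : elemext M N) (A : paramset M) G
    (phi : pformula A G) (a : env N G) : R :=
  feval (pfor phi) (ecat a (fun i => emb j (@ppar _ _ _ phi i))).

(* A-definable predicates: uniform limits of formulas over A. *)
Definition Def M (A : paramset M) G : set (env M G -> R) :=
  [set P | forall e : R, 0 < e -> exists phi : pformula A G,
     forall a, `|P a - pfeval (elemext_id M) phi a| <= e].

(* P represents a predicate on all elementary extensions; this is its value at
   a point of N. *)
Definition predext M N (j : elemext M N) (A : paramset M) G
    (P : env M G -> R) (a : env N G) : R :=
  get [set r : R | forall e : R, 0 < e -> exists phi : pformula A G,
     (forall b, `|P b - pfeval (elemext_id M) phi b| <= e) /\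
     `|r - pfeval j phi a| <= e].

Definition same_type M N (j : elemext M N) (A : paramset M) s (a : M s) (a' : N s) :=
  forall phi : pformula A (c1 s),
    pfeval j phi (fun=> a') = pfeval (elemext_id M) phi (fun=> a).

(* Elements with compact orbit over A.  In a saturated extension the orbit of a
   is the set of realizations of tp(a/A), which is closed; it is compact iff it
   is totally bounded.  As prestructures need not be complete, total boundedness
   in every elementary extension is what is asked. *)
Definition acl M (A : paramset M) : paramset M := fun s =>
  [set a | forall N (j : elemext M N) (e : R), 0 < e ->
     exists n (c : 'I_n -> N s),
       forall a', same_type j A a a' -> exists i, dist (c i) a' < e].

(* For a set Phi of predicates on the tuples of context G: the space of types
   that assign a value to each member of Phi, where a type is a finitely
   satisfiable assignment; its topology (the logic topology) is that of
   pointwise convergence on Phi. *)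
Definition types M G (Phi : set (env M G -> R)) : set {ptws Phi -> R} :=
  [set p | forall k (chi : 'I_k -> Phi) (e : R), 0 < e ->
     exists a : env M G, forall i, `|\val (chi i) a - p (chi i)| < e].

Arguments Def {M} A {G}.
Arguments types {M G} Phi.

Definition toset (T : Type) (A : set T) (x : T) (h : A x) : A :=
  exist (fun x => x \in A) x (mem_set h).

Definition incl (T : Type) (V U : set T) (s : V `<=` U) (x : V) : U :=
  toset (s _ (set_mem (valP x))).

Lemma types_restr M G (Phi Psi : set (env M G -> R)) (s : Psi `<=` Phi)
  (p : {ptws Phi -> R}) : types Phi p -> types Psi (fun chi : Psi => p (incl s chi)).
Proof. by move=> hp k chi e e0; apply: (hp k (fun i => incl s (chi i))). Qed.

Definition restr M G (Phi Psi : set (env M G -> R)) (s : Psi `<=` Phi)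
    (p : types Phi) : types Psi :=
  toset (types_restr s (set_mem (valP p))).

End Semantics.
Arguments Def {R L M} A {G}.
Arguments types {R L M G} Phi.

Section Imaginaries.
Variables (R : realType) (L : signature).

(* Forced limit (Ben Yaacov-Usvyatsov): it agrees with lim a when |a (n+1) - a n| <= 2^-(n+1). *)
Fixpoint flim_seq (a : nat -> R) (n : nat) : R :=
  if n is m.+1 then
    Num.max (flim_seq a m - 2 ^- n) (Num.min (flim_seq a m + 2 ^- n) (a n))
  else a 0%N.
Definition flim (a : nat -> R) : R := limn (flim_seq a).

(* A definable predicate Psi(x; y) = Flim_n psi_n(x; y_n) with x finite and
   y = (y_n) a possibly infinite tuple; it indexes the sort of the canonical
   parameters of the predicates Psi(x; b). *)
Record imsort := ImSort {
  im_x : ctx (Sort L);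
  im_y : nat -> ctx (Sort L);
  im_f : forall n, formula R (ccat im_x (im_y n)) }.

Definition eqsig : signature := {|
  Sort := (Sort L + imsort)%type;
  fsym := fsym L;
  farity := fun f => cmap inl (farity f);
  fcod := fun f => inl (fcod f);
  psym := (psym L + imsort)%type;
  parity := fun P => match P with
    | inl P => cmap inl (parity P)
    | inr psi => cext (cmap inl (im_x psi)) (inr psi)
    end |}.

Variable M : structure R L.

(* The canonical parameter of Psi(x; b) is represented by the function
   Psi(.; b); uniform closure is the completion for the canonical distance
   sup_x |Psi(x; b) - Psi(x; b')|. *)
Definition imag (psi : imsort) : Type :=
  {f : env M (im_x psi) -> R |
    (forall x, 0 <= f x <= 1) /\
    forall e : R, 0 < e -> exists b : forall n, env M (im_y psi n),
      forall x, `|f x - flim (fun n => feval (im_f psi n) (ecat x (b n)))| <= e}.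

Definition eqcar (s : Sort eqsig) : Type :=
  match s with inl s => M s | inr psi => imag psi end.

Definition imdist (psi : imsort) (f g : imag psi) : R :=
  sup (range (fun x => `|sval f x - sval g x|)).

Definition eqdist (s : Sort eqsig) : eqcar s -> eqcar s -> R :=
  match s with inl s => @dist R L M s | inr psi => @imdist psi end.

Lemma imdist_ub psi (f g : imag psi) x : `|sval f x - sval g x| <= 1.
Proof.
have /andP[f0 f1] := (proj2_sig f).1 x; have /andP[g0 g1] := (proj2_sig g).1 x.
by rewrite ler_norml; apply/andP; split; lra.
Qed.

Lemma imdist_le psi (f g : imag psi) x : `|sval f x - sval g x| <= imdist f g.
Proof.
apply: ub_le_sup; last by exists x.
by exists 1 => _ [y _ <-]; exact: imdist_ub.
Qed.

Lemma le_imdist psi (f g : imag psi) (r : R) : 0 <= r ->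
  (forall x, `|sval f x - sval g x| <= r) -> imdist f g <= r.
Proof.
move=> r0 h; rewrite /imdist; set S := (X in sup X).
have [->|/set0P S0] := eqVneq S set0; first by rewrite sup0.
by apply: ge_sup => // _ [x _ <-].
Qed.

Lemma imdist_ge0 psi (f g : imag psi) : 0 <= imdist f g.
Proof.
rewrite /imdist; set S := (X in sup X).
have [->|/set0P [_ [x _ _]]] := eqVneq S set0; first by rewrite sup0.
exact: le_trans (normr_ge0 _) (imdist_le f g x).
Qed.

Lemma eqdist01 s (a b : eqcar s) : 0 <= eqdist a b <= 1.
Proof.
case: s a b => [s a b|psi f g]; first exact: dist01.
by rewrite /= imdist_ge0 /= le_imdist // => x; exact: imdist_ub.
Qed.

Lemma eqdist_refl s (a : eqcar s) : eqdist a a = 0.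
Proof.
case: s a => [s a|psi f]; first exact: dist_refl.
apply/eqP; rewrite eq_le imdist_ge0 andbT.
by apply: le_imdist => // x; rewrite subrr normr0.
Qed.

Lemma eqdist_sym s (a b : eqcar s) : eqdist a b = eqdist b a.
Proof.
case: s a b => [s a b|psi f g]; first exact: dist_sym.
rewrite /= /imdist; congr (sup _); apply: eq_imagel => x _; exact: distrC.
Qed.

Lemma eqdist_tri s (a b c : eqcar s) : eqdist a c <= eqdist a b + eqdist b c.
Proof.
case: s a b c => [s a b c|psi f g h]; first exact: dist_tri.
apply: le_imdist => [|x]; first by rewrite addr_ge0 ?imdist_ge0.
apply: le_trans (ler_distD (sval g x) _ _) _.
by apply: lerD; exact: imdist_le.
Qed.

Definition eqpint (P : psym eqsig) :
    (forall i : cvar (parity P), eqcar (csort i)) -> R :=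
  match P with
  | inl P => @pint R L M P
  | inr psi => fun a => sval (a None : imag psi) (fun i => a (Some i))
  end.

Lemma eqpint01 P a : 0 <= @eqpint P a <= 1.
Proof.
by case: P a => [P a|psi a]; [exact: pint01 | exact: (proj2_sig (a None)).1].
Qed.

Definition eqstr : structure R eqsig :=
  @Structure R eqsig eqcar eqdist eqdist01 eqdist_refl eqdist_sym eqdist_tri
    (@fint R L M) eqpint eqpint01.

Definition realpar (A : paramset M) : paramset eqstr :=
  fun s => match s return set (eqcar s) with inl s => A s | inr _ => set0 end.

Definition acleq (A : paramset M) : paramset eqstr := acl (realpar A).

Definition reduct (N : structure R eqsig) : structure R L :=
  @Structure R L (fun s => N (inl s)) (fun s => @dist R eqsig N (inl s))
    (fun s => @dist01 R eqsig N (inl s)) (fun s => @dist_refl R eqsig N (inl s))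
    (fun s => @dist_sym R eqsig N (inl s)) (fun s => @dist_tri R eqsig N (inl s))
    (@fint R eqsig N) (fun P => @pint R eqsig N (inl P))
    (fun P => @pint01 R eqsig N (inl P)).

Definition rctx (G : ctx (Sort L)) : ctx (Sort eqsig) := cmap inl G.

(* delta(a; b) in an L^eq-structure, a and b being tuples of real sorts. *)
Definition deval (Gu Gv : ctx (Sort L)) (delta : formula R (ccat Gu Gv))
    (N : structure R eqsig) (a : env N (rctx Gu)) (b : env N (rctx Gv)) : R :=
  feval (M := reduct N) delta
    (@ecat R L (reduct N) Gu Gv (a : env (reduct N) Gu) b).

End Imaginaries.

(* A nonempty space with a base point (library measurable types are pointed),
   and its Borel sigma-algebra. *)
Definition pted (T : topologicalType) (t0 : T) : Type := T.
HB.instance Definition _ (T : topologicalType) (t0 : T) :=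
  Topological.on (pted t0).
HB.instance Definition _ (T : topologicalType) (t0 : T) :=
  isPointed.Build (pted t0) t0.

Definition Borel (T : topologicalType) (t0 : T) :=
  g_sigma_algebraType (@open (pted t0)).

Definition regular_measure (R : realType) (T : topologicalType) (t0 : T)
    (mu : set (Borel t0) -> \bar R) :=
  forall (A : set (Borel t0)) (e : R), measurable A -> 0 < e ->
    exists K O : set T, [/\ compact K, open O, K `<=` A, A `<=` O &
      (mu (O `\` K) < e%:E)%E].

Section Barycenters.
Variables (R : realType) (L : signature) (M : structure R L).
Variable E : paramset (eqstr M).
Variables (Gu Gv : ctx (Sort L)) (delta : formula R (ccat Gu Gv)).

(* Uniform limits of continuous combinations of instances delta(u; b). *)
Definition dpred : set (env (eqstr M) (rctx R Gu) -> R) :=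
  [set chi | forall e : R, 0 < e ->
     exists k (c : connective R k) (b : 'I_k -> env (eqstr M) (rctx R Gv)),
       forall a, `|chi a - c (\row_i deval delta a (b i))| <= e].

Definition DefE : set (env (eqstr M) (rctx R Gu) -> R) := Def E.

(* delta-predicates over E; their instances may use parameters outside E. *)
Definition dDefE : set (env (eqstr M) (rctx R Gu) -> R) := DefE `&` dpred.

Definition S1 : topologicalType := types DefE.
Definition Sdelta : topologicalType := types dDefE.

Definition rdelta (p : S1) : Sdelta := restr (@subIsetl _ DefE dpred) p.

(* P is a good definition of p: over every elementary extension N the conditions
   delta(x; b) = P(b), b in N, together with p, are consistent. *)
Definition good_definition (p : Sdelta) (P : env (eqstr M) (rctx R Gv) -> R) :=
  Def E P /\
  forall (N : structure R (eqsig R L)) (j : elemext (eqstr M) N)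
         k (b : 'I_k -> env N (rctx R Gv)) l (chi : 'I_l -> dDefE) (e : R),
    0 < e -> exists a : env N (rctx R Gu),
      (forall i, `|deval delta a (b i) - predext j E P (b i)| < e) /\
      (forall i, `|predext j E (\val (chi i)) a - \val p (chi i)| < e).

Definition barycenter (p0 : Sdelta) (mu : set (Borel p0) -> \bar R)
    (B : env (eqstr M) (rctx R Gv) -> R) :=
  Def E B /\
  exists d : Sdelta -> (env (eqstr M) (rctx R Gv) -> R),
    (forall p, good_definition p (d p)) /\
    forall (N : structure R (eqsig R L)) (j : elemext (eqstr M) N)
           (b : env N (rctx R Gv)),
      mu.-integrable setT (fun p : Borel p0 => (predext j E (d p) b)%:E) /\
      ((predext j E B b)%:E =
        \int[mu]_(p in setT) (predext j E (d p) b)%:E)%E.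

Definition pushr (q0 : S1) (rho : set (Borel q0) -> \bar R) :
    set (Borel (rdelta q0)) -> \bar R :=
  pushforward (T1 := Borel q0) (T2 := Borel (rdelta q0)) rho rdelta.

Definition complete_barycenter (q0 : S1) (rho : set (Borel q0) -> \bar R)
    (B : env (eqstr M) (rctx R Gv) -> R) := barycenter (pushr rho) B.

Definition complete_lift (q0 : S1) (mu : set (Borel (rdelta q0)) -> \bar R)
    (rho : set (Borel q0) -> \bar R) :=
  forall A : set (Borel (rdelta q0)), measurable A -> pushr rho A = mu A.

End Barycenters.
Arguments rdelta {R L M E Gu Gv} delta p.
Arguments Sdelta {R L M} E {Gu Gv} delta.
Arguments S1 {R L M} E Gu.
Arguments barycenter {R L M E Gu Gv delta p0} mu B.
Arguments pushr {R L M E Gu Gv} delta {q0} rho _.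
Arguments complete_barycenter {R L M E Gu Gv} delta {q0} rho B.
Arguments complete_lift {R L M E Gu Gv} delta {q0} mu rho.

Section Harmonic.
Variables (R : realType) (X : topologicalType).
Implicit Types U V W : set X.

Definition bd V : set X := closure V `\` V°.

Definition boundary_values V (h : V -> R) (g : bd V -> R) :=
  forall (z : bd V) (e : R), 0 < e ->
    \forall x \near nbhs (\val z), forall y : V, \val y = x -> `|h y - g z| < e.

Variable H : forall U, set (U -> R).
Variable tau0 : set (set X).

Record brelot_space : Prop := BrelotSpace {
  br_lc : locally_compact [set: X];
  br_lconn : forall (x : X) A, nbhs x A ->
    exists W, [/\ open W, connected W, W x & W `<=` A];
  br_hausdorff : hausdorff_space X;
  br_zero : forall U, open U -> H (fun _ : U => 0);
  br_add : forall U (f g : U -> R), open U -> H f -> H g ->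
    H (fun x => f x + g x);
  br_scale : forall U (c : R) (f : U -> R), open U -> H f -> H (fun x => c * f x);
  br_cont : forall U (f : U -> R), open U -> H f -> continuous f;
  br_restr : forall U V (s : V `<=` U) (f : U -> R), open U -> open V ->
    H f -> H (fun x => f (incl s x));
  br_glue : forall U (f : U -> R), open U ->
    (forall x, U x -> exists V (s : V `<=` U),
       [/\ open V, V x & H (fun y => f (incl s y))]) -> H f;
  br_base : forall (x : X) A, nbhs x A -> exists V, [/\ tau0 V, V x & V `<=` A];
  br_open : forall V, tau0 V -> open V;
  br_precompact : forall V, tau0 V -> precompact V;
  br_dirichlet : forall V (g : bd V -> R), tau0 V -> continuous g ->
    exists! h : V -> R, H h /\ boundary_values h g;
  br_positive : forall V (g : bd V -> R) (h : V -> R), tau0 V -> continuous g ->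
    H h -> boundary_values h g -> (forall z, 0 <= g z) -> forall x, 0 <= h x;
  br_convergence : forall U (f : nat -> U -> R), tau0 U -> connected U ->
    (forall n, H (f n)) -> (forall n x, f n x <= f n.+1 x) ->
    (forall x, f n x @[n --> \oo] --> +oo) \/
    (exists2 h : U -> R, H h & forall x, f n x @[n --> \oo] --> h x) }.

(* U is meant to be connected: finiteness at one point suffices. *)
Definition superharmonic U (s : U -> \bar R) :=
  [/\ lower_semicontinuous s, forall x, (-oo < s x)%E,
      exists x, (s x < +oo)%E &
      forall V (g : bd V -> R) (h : V -> R), tau0 V -> closure V `<=` U ->
        continuous g -> H h -> boundary_values h g ->
        (forall (z : bd V) (y : U), \val z = \val y -> ((g z)%:E <= s y)%E) ->
        forall (x : V) (y : U), \val x = \val y -> ((h x)%:E <= s y)%E].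

Definition potential U (s : U -> \bar R) :=
  [/\ superharmonic s, forall x, (0 <= s x)%E &
      forall h : U -> R, H h -> (forall x, ((h x)%:E <= s x)%E) ->
        forall x, h x <= 0].

(* A Greenian domain carries a positive potential. *)
Definition greenian U :=
  exists2 s : U -> \bar R, potential s & forall x, (0 < s x)%E.

Definition metrizes (T : topologicalType) (d : T -> T -> R) :=
  forall (x : T) (A : set T),
    nbhs x A <-> exists2 e : R, 0 < e & [set y | d x y < e] `<=` A.

End Harmonic.

Section GlobalData.
Variables (R : realType) (X : topologicalType) (H : forall U : set X, set (U -> R)).
Variables (tau0 : set (set X)) (U : tau0) (x0 : \val U) (C : nat -> set X).
Variable A : set X.

Inductive glsort :=
| SX
| SU of tau0
| SH of tau0
| SB of tau0
| SC of nat
| SH1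
| SY.

Definition Ax0 : set X := A `|` [set \val x0].

Definition H1plus : set (\val U -> R) :=
  [set h | [/\ H h, forall x, 0 <= h x & h x0 = 1]].

(* Functions carry compact convergence, boundary functions uniform convergence;
   Y_U is the one-point compactification of the topological sum of the C n. *)
Definition glcar (s : glsort) : topologicalType :=
  match s with
  | SX => X
  | SU V => set_type (\val V)
  | SH V => set_type (@H (\val V) : set {family compact, \val V -> R})
  | SB V => set_type ([set g | continuous (g : bd (\val V) -> R)] :
                        set {uniform bd (\val V) -> R})
  | SC n => set_type (C n)
  | SH1 => set_type (H1plus : set {family compact, \val U -> R})
  | SY => one_point_compactification {n : nat & C n}
  end.

(* The constants gl_cst, the sort SH1 and its inclusion come from the
   Ax0-definitional expansion; the other symbols of a definitional expansion
   change neither definable predicates nor types. *)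
Inductive glfun :=
| gl_UX (V : tau0)
| gl_UV (V W : tau0) of \val V `<=` \val W
| gl_res (V W : tau0) of \val V `<=` \val W
| gl_dir (V : tau0)
| gl_cst of Ax0
| gl_CU of nat
| gl_H1
| gl_star
| gl_iota of nat.

(* gl_eval V k is the real-valued symbol Eval_V truncated to [-(k+1), k+1] and
   rescaled to [0, 1]. *)
Inductive glpred :=
| gl_eval of tau0 & nat
| gl_theta of nat
| gl_Theta.

Definition glsig : signature := {|
  Sort := glsort;
  fsym := glfun;
  farity := fun f => match f with
    | gl_UX V => c1 (SU V)
    | gl_UV V W _ => c1 (SU V)
    | gl_res V W _ => c1 (SH W)
    | gl_dir V => c1 (SB V)
    | gl_cst _ => cnil glsort
    | gl_CU n => c1 (SC n)
    | gl_H1 => c1 SH1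
    | gl_star => cnil glsort
    | gl_iota n => c1 (SC n)
    end;
  fcod := fun f => match f with
    | gl_UX V => SX
    | gl_UV V W _ => SU W
    | gl_res V W _ => SH V
    | gl_dir V => SH V
    | gl_cst _ => SU U
    | gl_CU n => SU U
    | gl_H1 => SH U
    | gl_star => SY
    | gl_iota n => SY
    end;
  psym := glpred;
  parity := fun P => match P with
    | gl_eval V _ => c2 (SU V) (SH V)
    | gl_theta n => c2 SH1 (SC n)
    | gl_Theta => c2 SH1 SY
    end |}.

Record connective_basis (C0 : forall n, set (connective R n)) : Prop := {
  cb_countable : forall n, countable (C0 n);
  cb_rational_PL : forall n c, C0 n c ->
    exists m (a : 'I_m -> 'rV[rat]_n) (b : 'I_m -> rat),
      forall x, cube x -> exists i,
        c x = \sum_(j < n) ratr (a i 0 j) * x 0 j + ratr (b i);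
  cb_min : exists2 c, C0 2%N c & forall x, cube x -> c x = Num.min (x 0 0) (x 0 1);
  cb_max : exists2 c, C0 2%N c & forall x, cube x -> c x = Num.max (x 0 0) (x 0 1);
  cb_scale : forall q : rat, exists2 c, C0 1%N c & forall x, cube x ->
    c x = Num.max 0 (Num.min 1 (ratr q * x 0 0));
  cb_dense : forall n (f : connective R n) (e : R), 0 < e ->
    exists2 c, C0 n c & forall x, cube x -> `|c x - f x| <= e }.

(* Substitutes for the variables of a formula of Delta_U: variables (renaming)
   and iota_n(x) with x a variable of sort C_n (pullback). *)
Inductive rename_or_pullback (G : ctx glsort) :
    forall s, @term glsig G s -> Prop :=
| RPvar (i : cvar G) : rename_or_pullback (Var (L := glsig) i)
| RPiota n (i : cvar G) (t : forall k : unit, @term glsig G (SC n)) :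
    (exists e : csort i = SC n,
       t tt = eq_rect _ (@term glsig G) (Var (L := glsig) i) _ e) ->
    rename_or_pullback (App (L := glsig) (f := gl_iota n) t).

Definition Theta_formula : formula (L := glsig) R (ccat (c1 SH1) (c1 SY)) :=
  FPred R (L := glsig) (P := gl_Theta)
    (fun i : bool => match i return @term glsig (ccat (c1 SH1) (c1 SY)) (if i then SH1 else SY) with
     | true => Var (L := glsig) (G := ccat (c1 SH1) (c1 SY)) (inl tt)
     | false => Var (L := glsig) (G := ccat (c1 SH1) (c1 SY)) (inr tt)
     end).

Inductive DeltaU (C0 : forall n, set (connective R n)) :
    forall Gu Gv : ctx glsort, formula (L := glsig) R (ccat Gu Gv) -> Prop :=
| DU_Theta : DeltaU C0 Theta_formula
| DU_conn Gu Gv n (c : connective R n)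
    (phi : 'I_n -> formula (L := glsig) R (ccat Gu Gv)) :
    C0 n c -> (forall i, DeltaU C0 (phi i)) -> DeltaU C0 (FConn c phi)
| DU_subst Gu Gv Gu' Gv' (phi : formula (L := glsig) R (ccat Gu Gv))
    (su : @tsubstitution glsig Gu Gu') (sv : @tsubstitution glsig Gv Gv') :
    DeltaU C0 phi ->
    (forall i, rename_or_pullback (su i)) ->
    (forall i, rename_or_pullback (sv i)) ->
    DeltaU C0 (fsubst phi (scat su sv))
| DU_swap Gu Gv (phi : formula (L := glsig) R (ccat Gu Gv)) :
    DeltaU C0 phi -> DeltaU C0 (fsubst phi sswap).

Variable c : nat -> R.
Hypothesis brelotX : brelot_space H tau0.
Hypothesis c_ge1 : forall n, 1 <= c n.
Hypothesis c_harnack : forall n (h : \val U -> R) (x : \val U),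
  H h -> (forall y, 0 <= h y) -> C n (\val x) -> h x <= c n * h x0.
Hypothesis CU : forall n, C n `<=` \val U.
Hypothesis AU : A `<=` \val U.

Definition theta (n : nat) (h : glcar SH1) (x : C n) : R :=
  \val h (incl (@CU n) x) / c n.

Definition Theta (h : glcar SH1) (y : glcar SY) : R :=
  if y is Some (existT n x) then 2 ^- n * theta h x else 0.

Lemma theta01 n (h : glcar SH1) (x : C n) : 0 <= theta h x <= 1.
Proof.
have [Hh h0 h1] := set_mem (valP h).
have c0 : 0 < c n by exact: lt_le_trans (c_ge1 n).
rewrite /theta; apply/andP; split; first exact: divr_ge0 (h0 _) (ltW c0).
rewrite ler_pdivrMr // mul1r -[leRHS]mulr1 -h1; apply: c_harnack => //.
exact: (set_mem (valP x)).
Qed.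

Lemma Theta01 (h : glcar SH1) (y : glcar SY) : 0 <= Theta h y <= 1.
Proof.
case: y => [[n x]|] /=; last by rewrite lexx ler01.
have /andP[t0 t1] := theta01 h x.
have p0 : 0 < 2 ^+ n :> R by rewrite exprn_gt0.
have i0 : 0 <= 2 ^- n :> R by rewrite invr_ge0 ltW.
apply/andP; split; first exact: mulr_ge0.
by apply: mulr_ile1 => //; rewrite invf_le1 // exprn_ege1 // ler1n.
Qed.

Definition dirichlet (V : tau0) (g : glcar (SB V)) : glcar (SH V) :=
  let e := cid (br_dirichlet brelotX (set_mem (valP V)) (set_mem (valP g))) in
  toset (A := @H (\val V)) (projT2 e).1.1.

Lemma H_restr (V W : tau0) (s : \val V `<=` \val W) (h : glcar (SH W)) :
  H (fun x => \val h (incl s x)).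
Proof.
by apply: (br_restr brelotX); [exact: (br_open brelotX (set_mem (valP W)))
  | exact: (br_open brelotX (set_mem (valP V))) | exact: (set_mem (valP h))].
Qed.

Lemma H1_H (h : glcar SH1) : H (\val h).
Proof. by have [] := set_mem (valP h). Qed.

Lemma Ax0U : Ax0 `<=` \val U.
Proof. by move=> _ [/AU //|->]; exact: (set_mem (valP x0)). Qed.

Definition glfint (f : glfun) :
    (forall i : cvar (farity (s := glsig) f), glcar (csort i)) ->
    glcar (fcod (s := glsig) f) :=
  match f with
  | gl_UX V => fun a => \val (a tt : glcar (SU V))
  | gl_UV V W s => fun a => incl s (a tt)
  | gl_res V W s => fun a => toset (A := @H (\val V)) (H_restr s (a tt))
  | gl_dir V => fun a => dirichlet (a tt)
  | gl_cst b => fun=> incl Ax0U b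
  | gl_CU n => fun a => incl (@CU n) (a tt)
  | gl_H1 => fun a => toset (A := @H (\val U)) (H1_H (a tt))
  | gl_star => fun=> None
  | gl_iota n => fun a => Some (existT _ n (a tt))
  end.

Definition clamp01 (r : R) : R := Num.max 0 (Num.min 1 r).

Lemma clamp01P r : 0 <= clamp01 r <= 1.
Proof. by rewrite /clamp01 le_max lexx /= ge_max ler01 ge_min lexx. Qed.

Definition glpint (P : glpred) :
    (forall i : cvar (parity (s := glsig) P), glcar (csort i)) -> R :=
  match P with
  | gl_eval V k => fun a =>
      clamp01 ((\val (a false : glcar (SH V)) (a true) + k.+1%:R) / (2 * k.+1%:R))
  | gl_theta n => fun a => @theta n (a true) (a false)
  | gl_Theta => fun a => Theta (a true) (a false)
  end.

Lemma glpint01 P a : 0 <= @glpint P a <= 1.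
Proof.
by case: P a => [V k|n|] a; [exact: clamp01P | exact: theta01 | exact: Theta01].
Qed.

Variable d : forall s : glsort, glcar s -> glcar s -> R.
Hypothesis d01 : forall s (a b : glcar s), 0 <= d a b <= 1.
Hypothesis d_refl : forall s (a : glcar s), d a a = 0.
Hypothesis d_sym : forall s (a b : glcar s), d a b = d b a.
Hypothesis d_tri : forall s (a b e : glcar s), d a e <= d a b + d b e.

Definition glstr : structure R glsig :=
  @Structure R glsig glcar d d01 d_refl d_sym d_tri glfint glpint glpint01.

Inductive Ax0mem : forall s : glsort, glcar s -> Prop :=
| Ax0mem_intro (a : Ax0) : @Ax0mem (SU U) (incl Ax0U a).

End GlobalData.

Record setting (R : realType) := Setting {
  spX : topologicalType;
  spH : forall U : set spX, set (U -> R);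
  sptau0 : set (set spX);
  sp_brelot : brelot_space spH sptau0;
  dom : sptau0;
  pt : \val dom;
  dom_connected : connected (\val dom);
  dom_greenian : greenian spH sptau0 (\val dom);
  dset : set spX;
  dset_sub : dset `<=` \val dom;
  dset_dense : \val dom `<=` closure dset;
  exh : nat -> set spX;
  exh_compact : forall n, compact (exh n);
  exh_incr : forall n, exh n `<=` (exh n.+1)°;
  exh_cover : \bigcup_n exh n = \val dom;
  exh_pt : exh 0%N (\val pt);
  exh_sub : forall n, exh n `<=` \val dom;
  hc : nat -> R;
  hc_ge1 : forall n, 1 <= hc n;
  hc_harnack : forall n (h : \val dom -> R) (x : \val dom),
    spH h -> (forall y, 0 <= h y) -> exh n (\val x) -> h x <= hc n * h pt;
  met : forall s : glsort sptau0,
    glcar spH pt exh s -> glcar spH pt exh s -> R;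
  met01 : forall s (a b : glcar spH pt exh s), 0 <= met a b <= 1;
  met_refl : forall s (a : glcar spH pt exh s), met a a = 0;
  met_sym : forall s (a b : glcar spH pt exh s), met a b = met b a;
  met_tri : forall s (a b e : glcar spH pt exh s), met a e <= met a b + met b e;
  met_compat : forall s, metrizes (@met s);
  (* Required of Theta as a predicate symbol of a continuous language. *)
  Theta_ucont : forall e : R, 0 < e -> exists2 r : R, 0 < r &
    forall (h h' : glcar spH pt exh (SH1 sptau0)) (y y' : glcar spH pt exh (SY sptau0)),
      met h h' < r -> met y y' < r ->
      `|Theta hc exh_sub h y - Theta hc exh_sub h' y'| < e }.

Arguments dset {R} _.
Arguments exh {R} _.
Arguments hc {R} _.
Arguments met {R} _ {_}.
Arguments spH {R} _ _.
Arguments sptau0 {R} _.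

Definition Lgl (R : realType) (S : setting R) : signature :=
  glsig (pt S) (dset S).

Definition Mgl (R : realType) (S : setting R) : structure R (Lgl S) :=
  glstr (A := dset S) (sp_brelot S) (@hc_ge1 _ S) (@hc_harnack _ S)
    (@exh_sub _ S) (@dset_sub _ S)
    (@met01 _ S) (@met_refl _ S) (@met_sym _ S) (@met_tri _ S).

Definition Ax0gl (R : realType) (S : setting R) : paramset (Mgl S) :=
  fun s => [set a | @Ax0mem _ _ _ _ _ _ _ _ (@dset_sub _ S) s a].
Arguments Ax0gl {R} S s _.

Definition Egl (R : realType) (S : setting R) : paramset (eqstr (Mgl S)) :=
  acleq (Ax0gl S).
Arguments Egl {R} S s _.

(* Main.v *)
Require Import Defs.
From HB Require Import structures.
From mathcomp Require Import all_boot all_order all_algebra.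
From mathcomp Require Import all_classical all_reals all_analysis.
From mathcomp Require Import finmap measurable_realfun lra.

Set Implicit Arguments.
Unset Strict Implicit.
Unset Printing Implicit Defensive.

Import Order.TTheory GRing.Theory Num.Theory numFieldNormedType.Exports.
Local Open Scope classical_set_scope.
Local Open Scope ring_scope.

(** The compactness of Y_U makes every formula of Delta_U far better than
stable: its instances form a totally bounded family for the uniform norm, and
everything follows from this.

Say that a kernel K(a; b) is totally bounded if for every e > 0 there is a
finite colouring of the b's such that K(.; b) and K(.; b') are uniformly
e-close as soon as b and b' have the same colour.  Theta_U(h; y) is totally
bounded because it is uniformly continuous in y, uniformly in h, and y ranges
over a compact sort ([Theta_totally_bounded]).  As in the theorem of Ascoli,
total boundedness is symmetric in the two variables
([totally_bounded_swap]); it is inherited by continuous combinations and by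
substitution, hence it holds on all of Delta_U ([DeltaU_totally_bounded]).

The rest holds for a totally bounded delta(u; v) in an arbitrary structure M
and for E the algebraic closure in M^eq of any set of parameters.  The
imaginary sort of the canonical parameters of the instances delta(.; b) is
totally bounded.  This is expressed by sentences, so it persists in elementary
extensions, and every canonical parameter has a compact orbit and belongs to E
([imag_acleq]).  Hence delta(.; b) is E-definable for every b in M, and
likewise delta(a; .) for every a in M.

Therefore a delta-type p over E assigns a value to each delta(.; b), and the
only possible good definition of p is d_p(b) = p(delta(.; b))
([good_definition_unique]).  It is one: a finite net of b's shows that some a
in M satisfies p approximately and has delta(a; b) close to d_p(b) uniformly in
b ([defpred_approx]).  So d_p is a uniform limit of the E-definable predicates
delta(a; .), and the same a witnesses the required consistency in every
elementary extension, where uniform estimates are preserved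
([defpred_good]).

For a measure mu, the predicate b |-> int d_p(b) dmu(p) is the only candidate
for the barycenter ([barycenter_unique]).  A finite net of a's cuts the type
space into finitely many Borel cells on each of which d_p is uniformly close to
a single delta(a_i; .) ([row_cells]).  With w_i the measure of the i-th cell,
int d_p dmu(p) is uniformly close to the E-definable convex combination
sum_i w_i delta(a_i; .), and the same estimate holds at the points of any
elementary extension; so it is E-definable and it is the barycenter
([mean_row_comb], [barycenter_mean]).  Since this integral only involves the
measure on the space of delta-types, the barycenter of a complete measure
depends only on its image there. *)

(** * Connectives and forced limits *)

Section Connectives.
Variable R : realType.

Lemma cube_compact n : compact (@cube R n).
Proof.
have := @rV_compact R n (fun=> `[0, 1]%classic) (fun=> @segment_compact R 0 1).
congr compact; apply/seteqP; split=> x /= h i; have := h i;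
  by rewrite /= in_itv.
Qed.

(** Heine-Cantor on the cube; the modulus is stated coordinatewise because that is
how closeness of the arguments of a connective arises. *)
Lemma connective_ucont n (c : connective R n) (e : R) : 0 < e ->
  exists2 r : R, 0 < r & forall x y : 'rV[R]_n, cube x -> cube y ->
    (forall i, `|x 0 i - y 0 i| <= r) -> `|c x - c y| <= e.
Proof.
move=> e0.
pose P (r : R) (x : 'rV[R]_n) := forall y, cube y ->
  (forall i, `|x 0 i - y 0 i| <= r) -> `|c x - c y| <= e.
have nc0 : near_covering_within (@cube R n).
  by apply/near_covering_withinP/compact_near_coveringP; exact: cube_compact.
have nc : \forall r \near (0:R)^'+, @cube R n `<=` P r.
  apply: nc0 => x cx; have := @capp_cont _ _ c.
  move=> /subspace_continuousP /(_ x cx) /cvgrPdist_lt.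
  have e2 : 0 < e / 2 by rewrite divr_gt0.
  move=> /(_ _ e2) /nbhs_ballP[r /= r0 hr].
  have r2 : 0 < r / 2 by rewrite divr_gt0.
  exists (ball x (r / 2), [set t | t < r / 2]) => /=.
    by split; [exact: nbhsx_ballx | exact: nbhs_right_lt].
  move=> [x' t] /= [bx' tr] cx' y cy hy.
  have hx' : `|c x - c x'| < e / 2.
    by apply: hr => //; apply: le_ball bx'; lra.
  have hy' : `|c x - c y| < e / 2.
    apply: hr => //; split=> // i j; rewrite (ord1 i).
    have := bx'.2 0 j; rewrite -!ball_normE /= => h.
    apply: le_lt_trans (ler_distD (x' 0 j) _ _) _.
    by have := hy j; lra.
  apply: le_trans (ler_distD (c x) _ _) _.
  by rewrite distrC; lra.
near (0:R)^'+ => r.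
by exists r => [//|x y cx cy]; apply: (near nc r).
Unshelve. all: by end_near. Qed.

Lemma row_cube n (f : 'I_n -> R) : (forall i, 0 <= f i <= 1) -> cube (\row_i f i).
Proof. by move=> h i; rewrite mxE. Qed.

End Connectives.

Section Flim.
Variable R : realType.
Implicit Types a b : nat -> R.

Lemma max_close (p p' u u' e : R) : `|p - p'| <= e -> `|u - u'| <= e ->
  `|Num.max p u - Num.max p' u'| <= e.
Proof.
rewrite !ler_norml => /andP[h1 h2] /andP[h3 h4].
by case: (leP p u) => ?; case: (leP p' u') => ?; apply/andP; split; lra.
Qed.

Lemma min_close (p p' u u' e : R) : `|p - p'| <= e -> `|u - u'| <= e ->
  `|Num.min p u - Num.min p' u'| <= e.
Proof.
rewrite !ler_norml => /andP[h1 h2] /andP[h3 h4].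
by case: (leP p u) => ?; case: (leP p' u') => ?; apply/andP; split; lra.
Qed.

(** One step of the forced limit is a max of a min, both 1-Lipschitz for the sup
norm, so no error accumulates along the sequence. *)
Lemma flim_seq_close a b n e : (forall k, (k <= n)%N -> `|a k - b k| <= e) ->
  `|flim_seq a n - flim_seq b n| <= e.
Proof.
elim: n => [|n ih] h /=; first exact: h.
have ihn : `|flim_seq a n - flim_seq b n| <= e.
  by apply: ih => k kn; apply: h; exact: leqW.
apply: max_close.
  by rewrite (_ : _ - _ = flim_seq a n - flim_seq b n) //; lra.
apply: min_close; last exact: h.
by rewrite (_ : _ - _ = flim_seq a n - flim_seq b n) //; lra.
Qed.

Lemma flim_seq_step a n : `|flim_seq a n.+1 - flim_seq a n| <= 2 ^- n.+1.
Proof.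
have c0 : 0 <= 2 ^- n.+1 :> R by rewrite invr_ge0 exprn_ge0.
rewrite /=; move: (flim_seq a n) (a n.+1) (2 ^- n.+1) c0 => p u c c0.
by case: (leP (p + c) u) => ?; case: (leP (p - c) _) => ?;
  rewrite ler_norml; apply/andP; split; lra.
Qed.

Lemma flim_seq_dist a n m :
  `|flim_seq a (n + m) - flim_seq a n| <= 2 ^- n - 2 ^- (n + m).
Proof.
elim: m => [|m ih]; first by rewrite addn0 !subrr normr0.
have h := flim_seq_step a (n + m).
have e : 2 * 2 ^- (n + m).+1 = 2 ^- (n + m) :> R.
  by rewrite exprS invfM mulrA divff ?mul1r.
rewrite addnS; apply: le_trans (ler_distD (flim_seq a (n + m)) _ _) _.
by move: e h ih; move: (2 ^- n) (2 ^- (n + m)) (2 ^- (n + m).+1) => *; lra.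
Qed.

Lemma flim_cvg a : cvgn (flim_seq a).
Proof.
apply/cauchy_cvgP/cauchy_exP => e e0.
have [n _ /(_ n (leqnn _)) /= hn] := near_infty_natSinv_expn_lt (PosNum e0).
exists (flim_seq a n), n => // m /= nm.
have := flim_seq_dist a n (m - n); rewrite subnKC // -ball_normE /= distrC.
have : 0 <= 2 ^- m :> R by rewrite invr_ge0 exprn_ge0.
by move: hn; rewrite /= div1r; lra.
Qed.

(** The steps are bounded by 2^-n whatever the sequence is, so the forced limit is
determined up to 2^-n by finitely many terms. *)
Lemma flim_dist a n : `|flim a - flim_seq a n| <= 2 ^- n.
Proof.
have ca := @flim_cvg a.
have c0 m : 0 <= 2 ^- m :> R by rewrite invr_ge0 exprn_ge0.
rewrite ler_distl; apply/andP; split.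
  apply: limr_ge => //; exists n => // m /= nm.
  have := flim_seq_dist a n (m - n); rewrite subnKC // ler_distl.
  by move=> /andP[+ _]; have := c0 m; lra.
apply: limr_le => //; exists n => // m /= nm.
have := flim_seq_dist a n (m - n); rewrite subnKC // ler_distl.
by move=> /andP[_ +]; have := c0 m; lra.
Qed.

Lemma flim_cst (x : R) : flim (fun=> x) = x.
Proof.
rewrite /flim (_ : flim_seq _ = fun=> x) ?lim_cst //.
apply/funext; elim=> [|n ih] //=; rewrite ih.
have c0 : 0 <= 2 ^- n.+1 :> R by rewrite invr_ge0 exprn_ge0.
by rewrite min_r ?max_r //; lra.
Qed.

End Flim.

Section SomeConnectives.
Variable R : realType.

Lemma coord_cont n (i : 'I_n) : continuous (fun x : 'rV[R]_n => x 0 i).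
Proof. exact: coord_continuous. Qed.

Lemma cont_connective n (f : 'rV[R]_n -> R) : continuous f ->
  (forall x, cube x -> 0 <= f x <= 1) ->
  {c : connective R n | forall x, c x = f x}.
Proof.
move=> cf f01.
pose cf' : {within @cube R n, continuous f} := continuous_subspaceT cf.
by exists (Connective cf' f01).
Qed.

Lemma conn_proj : {c : connective R 1 | forall x, c x = x 0 0}.
Proof. by apply: cont_connective => [|x]; [exact: coord_cont | exact]. Qed.

Lemma conn_one : {c : connective R 1 | forall x, c x = 1}.
Proof. by apply: cont_connective => [|x _]; [exact: cst_continuous | rewrite ler01 lexx]. Qed.

Lemma conn_dist : {c : connective R 2 | forall x, c x = `|x 0 0 - x 0 1|}.
Proof.
apply: cont_connective => x.
  apply: (@continuous_comp _ _ _ (fun y : 'rV[R]_2 => y 0 0 - y 0 1) Num.norm).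
    by apply: continuousB; exact: coord_cont.
  exact: norm_continuous.
move=> cx; rewrite normr_ge0 ler_norml; have := cx 0; have := cx 1.
by move=> /andP[? ?] /andP[? ?]; apply/andP; split; lra.
Qed.

(** The product vanishes iff some x_i is at most e; this turns the existence of a
close element in a finite list into a single inequality. *)
Lemma conn_prod n (e : R) : 0 <= e ->
  {c : connective R n | forall x, c x = \prod_(i < n) Num.max 0 (x 0 i - e)}.
Proof.
move=> e0; apply: cont_connective => [|x].
  apply: continuous_big; first exact: mul_continuous.
  move=> i _; apply: max_fun_continuous; first exact: cst_continuous.
  by move=> x; apply: continuousB; [exact: coord_cont | exact: cst_continuous].
move=> cx; have h i : 0 <= Num.max 0 (x 0 i - e) <= 1.
  rewrite le_max lexx /= ge_max ler01 /=.
  by have /andP[? ?] := cx i; lra.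
apply/andP; split; first by apply: prodr_ge0 => i _; case/andP: (h i).
by apply: prodr_ile1 => i _; exact: h.
Qed.

Lemma conn_wsum n (w : 'I_n -> R) : (forall i, 0 <= w i) -> \sum_(i < n) w i <= 1 ->
  {c : connective R n | forall x, c x = \sum_(i < n) w i * x 0 i}.
Proof.
move=> w0 w1; apply: cont_connective => [|x].
  apply: continuous_big; first exact: add_continuous.
  by move=> i _ x; apply: continuousM; [exact: cst_continuous | exact: coord_cont].
move=> cx; rewrite sumr_ge0 /=; last first.
  by move=> i _; apply: mulr_ge0; case/andP: (cx i).
apply: le_trans w1; apply: ler_sum => i _.
by rewrite ler_piMr //; case/andP: (cx i).
Qed.

End SomeConnectives.

(** * Totally bounded kernels *)

Section TotallyBounded.
Variable R : realType.

(** Total boundedness of the family K(., b) in the uniform norm, phrased with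
colourings rather than nets: colourings pull back along maps and combine by
products without any choice of representatives. *)
Definition totally_bounded (A B : Type) (K : A -> B -> R) :=
  forall e : R, 0 < e -> exists (F : finType) (col : B -> F),
    forall b b', col b = col b' -> forall a, `|K a b - K a b'| <= e.

Lemma coloring_net (B : Type) (F : finType) (col : B -> F) :
  exists n (c : 'I_n -> B), forall b, exists i, col (c i) = col b.
Proof.
have [[b0 _]|noB] := pselect (exists _ : B, True); last first.
  exists 0%N, (fun i : 'I_0 => match notF (ltn_ord i) with end) => b.
  by case: noB; exists b.
pose rep (k : F) := if pselect (exists b, col b = k) is left h then sval (cid h) else b0.
exists #|F|, (fun i => rep (enum_val i)) => b; exists (enum_rank (col b)).
rewrite enum_rankK /rep; case: pselect => [h|[]]; last by exists b.
exact: (svalP (cid h)).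
Qed.

Lemma quantize (e : R) : 0 < e -> exists (N : nat) (q : R -> 'I_N),
  forall x y, 0 <= x <= 1 -> 0 <= y <= 1 -> q x = q y -> `|x - y| <= e.
Proof.
move=> e0.
have [n _ /(_ n (leqnn _)) /= hn] := near_infty_natSinv_expn_lt (PosNum e0).
have hn' : 2 ^- n < e by move: hn; rewrite /= div1r.
(* 2 ^ n + 1 values, since x = 1 has to be allowed *)
exists (2 ^ n).+1, (fun x => inord (Num.truncn (x * 2 ^+ n))).
move=> x y /andP[x0 x1] /andP[y0 y1].
have p0 : 0 < 2 ^+ n :> R by rewrite exprn_gt0.
have lt (z : R) : 0 <= z -> z <= 1 -> (Num.truncn (z * 2 ^+ n) < (2 ^ n).+1)%N.
  move=> z0 z1; rewrite ltnS -(ler_nat R) natrX.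
  have zp : 0 <= z * 2 ^+ n by rewrite mulr_ge0 // ltW.
  have /andP[h _] := truncn_itv zp;
  apply: le_trans h _.
  by rewrite ler_piMl // ltW.
move=> /(congr1 (@nat_of_ord _)); rewrite !inordK ?lt // => h.
have /andP[hx hx'] := truncn_itv (mulr_ge0 x0 (ltW p0)).
have /andP[hy hy'] := truncn_itv (mulr_ge0 y0 (ltW p0)).
apply: le_trans (ltW hn'); rewrite -[leRHS]mul1r ler_pdivlMr //.
rewrite -[X in _ * X](ger0_norm (ltW p0)) -normrM mulrBl ler_norml.
rewrite -natr1 in hx' hy'; rewrite h in hx hx'.
by apply/andP; split; lra.
Qed.

(** Ascoli: once the b's are represented by finitely many c_i, a is described up
to a small error by the vector of the K(a, c_i), which lies in a cube. *)
Lemma totally_bounded_swap (A B : Type) (K : A -> B -> R) :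
  (forall a b, 0 <= K a b <= 1) -> totally_bounded K ->
  totally_bounded (fun b a => K a b).
Proof.
move=> K01 tbK e e0; have e3 : 0 < e / 3 by rewrite divr_gt0.
have [F [col hcol]] := tbK _ e3.
have [n [c hc]] := coloring_net col.
have [N [q hq]] := quantize e3.
exists {ffun 'I_n -> 'I_N}, (fun a => [ffun i => q (K a (c i))]) => a a' haa' b.
have [i hi] := hc b.
have h1 := hcol _ _ hi a; have h2 := hcol _ _ hi a'.
have h3 : `|K a (c i) - K a' (c i)| <= e / 3.
  by apply: hq => //; move/ffunP/(_ i): haa'; rewrite !ffunE.
by move: h1 h2 h3; rewrite !ler_norml => /andP[? ?] /andP[? ?] /andP[? ?];
  apply/andP; split; lra.
Qed.

End TotallyBounded.

Section Closure.
Variable R : realType.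

Lemma totally_bounded_comp (A B A' B' : Type) (K : A -> B -> R) (f : A' -> A) (h : B' -> B) :
  totally_bounded K -> totally_bounded (fun a b => K (f a) (h b)).
Proof.
move=> tbK e e0; have [F [col hcol]] := tbK _ e0.
by exists F, (col \o h) => b b' hb a; exact: hcol.
Qed.

Lemma totally_bounded_connective (A B : Type) n (c : connective R n) (K : 'I_n -> A -> B -> R) :
  (forall i a b, 0 <= K i a b <= 1) -> (forall i, totally_bounded (K i)) ->
  totally_bounded (fun a b => c (\row_i K i a b)).
Proof.
move=> K01 tbK e e0; have [r r0 hr] := connective_ucont c e0.
pose F i := sval (cid (tbK i r r0)).
have hF i : exists col : B -> F i, forall b b', col b = col b' ->
  forall a, `|K i a b - K i a b'| <= r := svalP (cid (tbK i r r0)).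
pose col i := sval (cid (hF i)).
have colP i : forall b b', col i b = col i b' ->
  forall a, `|K i a b - K i a b'| <= r := svalP (cid (hF i)).
exists {dffun forall i : 'I_n, F i}, (fun b => [ffun i => col i b]) => b b' hb a.
apply: hr => [||i]; [exact: row_cube | exact: row_cube |].
rewrite !mxE; apply: colP.
by have := congr1 (fun k : {dffun forall i : 'I_n, F i} => k i) hb; rewrite !ffunE.
Qed.

(** A finite cover by balls of radius r / 2; the colour of a point is the centre
of a ball that contains it. *)
Lemma compact_coloring (T : ptopologicalType) (d : T -> T -> R) (r : R) :
  compact [set: T] -> metrizes d -> (forall x y, d x y = d y x) ->
  (forall x y z, d x z <= d x y + d y z) -> 0 < r ->
  exists (F : finType) (col : T -> F), forall y y', col y = col y' -> d y y' < r.
Proof.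
move=> cT dT dC dD r0; have r2 : 0 < r / 2 by rewrite divr_gt0.
move: cT; rewrite compact_cover.
move=> /(_ _ setT (fun x => [set y | d x y < r / 2]°)) [].
- by move=> x _; exact: open_interior.
- move=> x _; exists x => //; apply/dT.
  by exists (r / 2).
move=> D _ cov.
have ex (y : T) : exists x : fset_sub_type D, d (fsval x) y < r / 2.
  have [x xD /interior_subset hx] := cov y I.
  by exists (FSetSub xD).
pose F : finType := fset_sub_type D.
exists F, (fun y => sval (cid (ex y))) => y y' h.
have h1 := svalP (cid (ex y)); have h2 := svalP (cid (ex y')).
apply: le_lt_trans (dD _ (fsval (sval (cid (ex y)))) _) _.
rewrite dC; move: h2; rewrite -h; move: h1 => /=; lra.
Qed.

End Closure.

(** * Borel functions and finite partitions *)

Section BorelFunctions.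

Lemma continuous_Borel_real (R : realType) (T : topologicalType) (t0 : T) (f : T -> R) :
  continuous f -> measurable_fun setT (f : Borel t0 -> R).
Proof.
move=> /continuousP cf; apply: (measurability _ (RGenOpens.measurableE R)).
move=> _ [_ [a [b ->] <-]]; rewrite setTI; apply: sub_sigma_algebra.
exact/cf/interval_open.
Qed.

Lemma continuous_Borel (T U : topologicalType) (t0 : T) (u0 : U) (f : T -> U) :
  continuous f -> measurable_fun setT (f : Borel t0 -> Borel u0).
Proof.
move=> /continuousP cf; apply: (@measurability _ _ (Borel t0) (Borel u0) setT f (@open (pted u0))) => //.

by move=> _ [A oA <-]; rewrite setTI; apply: sub_sigma_algebra; exact: cf.
Qed.

Lemma closed_Borel (T : topologicalType) (t0 : T) (A : set T) :
  closed A -> measurable (A : set (Borel t0)).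
Proof.
move=> cA; rewrite -[A]setCK; apply: measurableC; apply: sub_sigma_algebra.
exact: closed_openC.
Qed.

End BorelFunctions.

Section FiniteApproximation.
Context d (T : measurableType d) (R : realType) (mu : probability T R).
Variables (n : nat) (g : T -> 'I_n).
Hypothesis mg : forall i, measurable (g @^-1` [set i]).

Definition cell_weight (i : 'I_n) : R := fine (mu (g @^-1` [set i])).

Lemma cell_weight_ge0 i : 0 <= cell_weight i.
Proof. exact: fine_ge0. Qed.

Lemma probability_bounded_integrable (f : T -> R) (r : R) :
  measurable_fun setT f -> (forall t, `|f t| <= r) -> mu.-integrable setT (EFin \o f).
Proof.
move=> mf fr; apply: measurable_bounded_integrable => //.
  by rewrite [X in (X < _)%E](@probability_setT _ _ _ mu) ltry.
by exists r; split=> [|x xr t _]; [exact: num_real | exact: le_trans (fr t) (ltW xr)].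
Qed.

Lemma integral_cells (v : 'I_n -> R) :
  (\int[mu]_t (v (g t))%:E = (\sum_(i < n) cell_weight i * v i)%:E)%E.
Proof.
transitivity (\int[mu]_t (\sum_(i < n) (v i)%:E * (\1_(g @^-1` [set i]) t)%:E))%E.
  apply: eq_integral => t _; rewrite (bigD1 (g t)) //= indicE mem_set // mule1.
  rewrite big1 ?adde0 // => i ig; rewrite indicE memNset ?mule0 //=.
  by move=> /= gi; rewrite gi eqxx in ig.
have int1 i : mu.-integrable setT (EFin \o \1_(g @^-1` [set i])).
  exact: integrable_indic.
rewrite integral_sum //; last by move=> i; exact: (integrableZl measurableT _ (int1 i)).
rewrite -sumEFin; apply: eq_bigr => i _.
rewrite (integralZl measurableT (int1 i)) EFinM muleC /cell_weight fineK; last first.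
  exact: fin_num_measure.
by congr (_ * _)%E; rewrite [LHS]integral_indic // setIT.
Qed.

Lemma measurable_cells (v : 'I_n -> R) : measurable_fun setT (v \o g).
Proof.
move=> _ B mB; rewrite setTI.
rewrite (_ : _ @^-1` B = \bigcup_(i in [set i | B (v i)]) g @^-1` [set i]).
  by apply: fin_bigcup_measurable => // i _; exact: mg.
apply/seteqP; split=> [t Bt|t [i Bi /= gi]]; first by exists (g t).
by rewrite /= gi.
Qed.

(** A function that is e-close to v_i on the i-th cell of a finite partition has an
integral e-close to the corresponding weighted sum, since mu has mass 1. *)
Lemma integral_approx (f : T -> R) (v : 'I_n -> R) (e : R) :
  measurable_fun setT f -> (forall t, `|f t - v (g t)| <= e) ->
  `|\int[mu]_t f t - \sum_(i < n) cell_weight i * v i| <= e.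
Proof.
move=> mf fv.
have bv t : `|v (g t)| <= \sum_(i < n) `|v i|.
  by rewrite (bigD1 (g t)) //= lerDl; apply: sumr_ge0.
have iv : mu.-integrable setT (EFin \o (fun t => v (g t))).
  exact: probability_bounded_integrable (measurable_cells v) bv.
have intf : mu.-integrable setT (EFin \o f).
  apply: (@probability_bounded_integrable _ (e + \sum_(i < n) `|v i|)) => // t.
  by rewrite -[f t](subrK (v (g t))); apply: le_trans (ler_normD _ _) _; apply: lerD.
rewrite (_ : \sum_(i < n) _ = \int[mu]_t v (g t)); last first.
  by rewrite /Rintegral integral_cells.
rewrite -RintegralB //.
have ib : mu.-integrable setT (EFin \o (fun t => f t - v (g t))).
  apply: (@probability_bounded_integrable _ e) => //.
  by apply: measurable_funB => //; exact: measurable_cells.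
apply: le_trans (le_normr_Rintegral _ ib) _ => //.
rewrite (_ : e = \int[mu]_(_ in setT) e); last first.
  by rewrite Rintegral_cst // [X in fine X](@probability_setT _ _ _ mu) mulr1.
apply: le_Rintegral => //; first exact: integrable_norm.
by apply: (@probability_bounded_integrable _ `|e|) => //; exact: measurable_cst.
Qed.

Lemma cell_weight_sum : \sum_(i < n) cell_weight i = 1.
Proof.
have := integral_cells (fun=> 1); rewrite integral_cst // [X in (_ * X)%E](@probability_setT _ _ _ mu) mule1.
by move=> [->]; apply: eq_bigr => i _; rewrite mulr1.
Qed.

End FiniteApproximation.

(** * Evaluation of formulas and transfer to elementary extensions *)

Section Semantics.
Variables (R : realType) (L : signature).
Implicit Types M N : structure R L.

(** The supremum over an empty sort is 0 by convention, so empty sorts need a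
separate treatment. *)
Lemma feval01 M G (phi : formula R G) (rho : env M G) : 0 <= feval phi rho <= 1.
Proof.
elim: phi rho => [{}G P t|{}G s t u|{}G n c psi ih|{}G s psi ih|{}G s psi ih] rho /=.
- exact: pint01.
- exact: dist01.
- by apply: capp01; apply: row_cube.
- set S := (X in sup X); have [->|/set0P [z [x _ zE]]] := eqVneq S set0.
    by rewrite sup0 lexx ler01.
  have h : has_ubound S by exists 1 => _ [y _ <-]; case/andP: (ih (eext rho y)).
  apply/andP; split.
    have Sx : S (feval psi (eext rho x)) by exists x.
    by apply: le_trans (ub_le_sup h Sx); case/andP: (ih (eext rho x)).
  by apply: ge_sup; [exists z, x|
    move=> _ [y _ <-]; case/andP: (ih (eext rho y))].
- set S := (X in inf X); have [->|/set0P [z [x _ zE]]] := eqVneq S set0.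
    by rewrite inf0 lexx ler01.
  have h : has_lbound S by exists 0 => _ [y _ <-]; case/andP: (ih (eext rho y)).
  apply/andP; split.
    by apply: lb_le_inf; [exists z, x|
      move=> _ [y _ <-]; case/andP: (ih (eext rho y))].
  have Sx : S (feval psi (eext rho x)) by exists x.
  by apply: le_trans (ge_inf h Sx) _; case/andP: (ih (eext rho x)).
Qed.

Lemma teval_tsubst M G G' (sg : tsubstitution G G') s (t : term G s) (rho : env M G') :
  teval rho (tsubst sg t) = teval (fun i => teval rho (sg i)) t.
Proof.
elim: t => [//|f u ih] /=; congr fint.
by apply: functional_extensionality_dep => i; exact: ih.
Qed.

Lemma feval_fsubst M G (phi : formula R G) G' (sg : tsubstitution G G')
    (rho : env M G') :
  feval (fsubst phi sg) rho = feval phi (fun i => teval rho (sg i)).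
Proof.
have eextE G1 G2 s (th : tsubstitution G1 G2) (r : env M G2) (a : M s) :
    (fun i => teval (eext r a) (sext th i)) = eext (fun i => teval r (th i)) a.
  by apply: functional_extensionality_dep => -[j|] //=; rewrite teval_tsubst.
elim: phi G' sg rho => [{}G P t|{}G s t u|{}G n c psi ih|{}G s psi ih|{}G s psi ih]
  G' sg rho /=.
- congr pint; apply: functional_extensionality_dep => i; exact: teval_tsubst.
- by rewrite !teval_tsubst.
- by congr (c _); apply/rowP => i; rewrite !mxE.
- by congr (sup _); apply: eq_imagel => a _; rewrite ih eextE.
- by congr (inf _); apply: eq_imagel => a _; rewrite ih eextE.
Qed.

Section VariableSup.
Variables (G : ctx (Sort L)).

(** Renaming the variable i of G to the new variable of the extended context; the
quantifiers bind only the last variable of a context. *)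
Definition replace_var (i : cvar G) : tsubstitution G (cext G (csort i)) :=
  fun k => match k =P i with
  | ReflectT e => eq_rect i (fun l => term (cext G (csort i)) (csort l))
      (Var (G := cext G (csort i)) None) k (esym e)
  | ReflectF _ => Var (G := cext G (csort i)) (Some k)
  end.

Definition fsup_var (i : cvar G) (phi : formula R G) : formula R G :=
  FSup (fsubst phi (replace_var i)).

Lemma replace_var_at M (rho : env M G) i (a : M (csort i)) :
  teval (eext rho a) (replace_var i i) = a.
Proof. by rewrite /replace_var; case: eqP => // e; rewrite (eq_axiomK e). Qed.

Lemma replace_var_off M (rho : env M G) i k (a : M (csort i)) : k != i ->
  teval (eext rho a) (replace_var i k) = rho k.
Proof. by rewrite /replace_var; case: eqP. Qed.

(** The supremum over the variables in l, written in the same context G: the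
variables in l become dummy, which avoids contexts indexed by what is left. *)
Definition fsup_vars (l : seq (cvar G)) (phi : formula R G) : formula R G :=
  foldr fsup_var phi l.

Lemma le_fsup_vars M l phi (rho rho' : env M G) :
  (forall k, k \notin l -> rho' k = rho k) ->
  feval phi rho' <= feval (fsup_vars l phi) rho.
Proof.
elim: l rho => [|i l ih] rho h /=.
  rewrite (_ : rho' = rho) //; apply: functional_extensionality_dep => k.
  exact: h.
have h' : feval phi rho' <=
    feval (fsup_vars l phi)
      (fun k => teval (eext rho (rho' i)) (replace_var i k)).
  apply: ih => k kl; have [->|ki] := eqVneq k i; first by rewrite replace_var_at.
  by rewrite replace_var_off // h // inE negb_or ki.
apply: le_trans h' _; rewrite -feval_fsubst.
pose chi := fsubst (fsup_vars l phi) (replace_var i).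
apply: ub_le_sup; last by exists (rho' i).
by exists 1 => _ [a _ <-]; case/andP: (feval01 chi (eext rho a)).
Qed.

Lemma fsup_vars_le M l phi (rho : env M G) (r : R) :
  (forall rho', (forall k, k \notin l -> rho' k = rho k) -> feval phi rho' <= r) ->
  feval (fsup_vars l phi) rho <= r.
Proof.
elim: l rho => [|i l ih] rho h /=; first exact: h.
pose chi := fsubst (fsup_vars l phi) (replace_var i).
apply: ge_sup; first by exists (feval chi (eext rho (rho i))), (rho i).
move=> _ [a _ <-]; rewrite feval_fsubst; apply: ih => rho' h'.
apply: h => k; rewrite inE negb_or => /andP[ki kl].
by rewrite h' // replace_var_off.
Qed.

End VariableSup.

Lemma emb_ecat M N (j : elemext M N) G H (a : env M G) (b : env M H) :
  (fun i => emb j (ecat a b i)) =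
  ecat (fun i => emb j (a i)) (fun i => emb j (b i)).
Proof. by apply: functional_extensionality_dep => -[]. Qed.

(** An elementary extension creates no element in an empty sort: the sentence
sup_x 1 has value 0 in an empty sort and 1 otherwise. *)
Lemma elemext_inhabited M N (j : elemext M N) s (b : N s) : exists _ : M s, True.
Proof.
apply: contrapT => h.
pose x0 : term (cext (cnil (Sort L)) s) s := Var (G := cext (cnil _) s) None.
have := emb_elem j (FSup (FConn (sval (conn_one R)) (fun=> FDist R x0 x0)))
  (fun i : void => match i with end).
rewrite /=; set S := (X in sup X = _); set T := (X in _ = sup X).
have -> : T = set0 by apply/seteqP; split=> // z [a _ _]; case: h; exists a.
have -> : S = [set 1].
  apply/seteqP; split=> [z [a _ <-] /=|z ->]; first exact: (svalP (conn_one R)).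
  by exists b => //=; exact: (svalP (conn_one R)).
by rewrite sup0 sup1 => /eqP; rewrite oner_eq0.
Qed.

Lemma elemext_env_inhabited M N (j : elemext M N) G (b : env N G) :
  exists _ : env M G, True.
Proof.
by exists (fun i => sval (cid (elemext_inhabited j (b i)))).
Qed.

(** Elementarity speaks of the points of M only; bounds valid at all points of M
pass to all points of N by quantifying over the context G. *)
Lemma transfer_le M N (j : elemext M N) G H (phi : formula R (ccat G H))
    (m : env M H) (r : R) :
  (forall a : env M G, feval phi (ecat a m) <= r) ->
  forall a : env N G, feval phi (ecat a (fun i => emb j (m i))) <= r.
Proof.
move=> h a; have [a0 _] := elemext_env_inhabited j a.
pose l : seq (cvar (ccat G H)) := map inl (enum (cvar G)).
have inl_l (i : cvar G) : inl i \in l by rewrite map_f // mem_enum.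
apply: (@le_trans _ _ (feval (fsup_vars l phi) (fun i => emb j (ecat a0 m i)))).
  by apply: le_fsup_vars => -[i|i] //; rewrite inl_l.
rewrite emb_elem; apply: fsup_vars_le => rho' h'.
suff -> : rho' = ecat (fun i => rho' (inl i)) m by [].
apply: functional_extensionality_dep => -[i|i] //=.
by rewrite h' //; apply/mapP => -[].
Qed.

End Semantics.

(** * Definable predicates in elementary extensions *)

Section Predext.
Variables (R : realType) (L : signature).
Implicit Types M N : structure R L.

Lemma transfer_dist M N (j : elemext M N) G H (phi psi : formula R (ccat G H))
    (m : env M H) (r : R) :
  (forall a : env M G, `|feval phi (ecat a m) - feval psi (ecat a m)| <= r) ->
  forall a : env N G, `|feval phi (ecat a (fun i => emb j (m i))) -
                        feval psi (ecat a (fun i => emb j (m i)))| <= r.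
Proof.
pose chi := FConn (sval (conn_dist R)) (fun i : 'I_2 => if i == 0 then phi else psi).
have chiE (K : structure R L) (rho : env K (ccat G H)) :
    feval chi rho = `|feval phi rho - feval psi rho|.
  by rewrite /= (svalP (conn_dist R)) !mxE.
by move=> h a; rewrite -chiE; apply: transfer_le => b; rewrite chiE.
Qed.

Section Approximation.
Variables (M N : structure R L) (j : elemext M N) (A : paramset M) (G : ctx (Sort L)).
Implicit Types (phi psi : pformula A G) (P Q : env M G -> R).

Lemma pformula_transfer phi psi (r : R) :
  (forall a, `|pfeval (elemext_id M) phi a - pfeval (elemext_id M) psi a| <= r) ->
  forall a, `|pfeval j phi a - pfeval j psi a| <= r.
Proof.
pose H := ccat (pctx phi) (pctx psi).
pose s1 : tsubstitution (ccat G (pctx phi)) (ccat G H) := fun i =>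
  match i with inl k => Var (G := ccat G H) (inl k)
  | inr k => Var (G := ccat G H) (inr (inl k)) end.
pose s2 : tsubstitution (ccat G (pctx psi)) (ccat G H) := fun i =>
  match i with inl k => Var (G := ccat G H) (inl k)
  | inr k => Var (G := ccat G H) (inr (inr k)) end.
pose m : env M H := ecat (@ppar _ _ _ _ _ phi) (@ppar _ _ _ _ _ psi).
have s1E (K : structure R L) (f : forall s, M s -> K s) (a : env K G) :
    (fun i => teval (ecat a (fun i => f _ (m i))) (s1 i)) =
    ecat a (fun i => f _ (@ppar _ _ _ _ _ phi i)).
  by apply: functional_extensionality_dep => -[].
have s2E (K : structure R L) (f : forall s, M s -> K s) (a : env K G) :
    (fun i => teval (ecat a (fun i => f _ (m i))) (s2 i)) =
    ecat a (fun i => f _ (@ppar _ _ _ _ _ psi i)).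
  by apply: functional_extensionality_dep => -[].
move=> h a; rewrite /pfeval -(s1E N (@emb _ _ _ _ j)) -(s2E N (@emb _ _ _ _ j)).
rewrite -!feval_fsubst; apply: transfer_dist => b; rewrite !feval_fsubst.
by rewrite (s1E M (fun _ x => x)) (s2E M (fun _ x => x)); exact: h.
Qed.

(** The values at a point of N of the formulas that approximate P form a Cauchy
family, so they determine a real number; it is built as the infimum of the
upper bounds that they give. *)
Lemma predext_approx P phi (e : R) a : Def A P ->
  (forall b, `|P b - pfeval (elemext_id M) phi b| <= e) ->
  `|predext j A P a - pfeval j phi a| <= e.
Proof.
move=> dP hphi.
pose S := [set t : R | exists psi r, (forall b, `|P b - pfeval (elemext_id M) psi b| <= r)
   /\ t = pfeval j psi a + r].
have key psi r psi' r' : (forall b, `|P b - pfeval (elemext_id M) psi b| <= r) ->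
    (forall b, `|P b - pfeval (elemext_id M) psi' b| <= r') ->
    pfeval j psi a - r <= pfeval j psi' a + r'.
  move=> h h'; have : `|pfeval j psi a - pfeval j psi' a| <= r + r'.
    apply: pformula_transfer => b; apply: le_trans (ler_distD (P b) _ _) _.
    by rewrite lerD // distrC.
  by rewrite ler_norml => /andP[_]; lra.
have infP psi r : (forall b, `|P b - pfeval (elemext_id M) psi b| <= r) ->
    `|inf S - pfeval j psi a| <= r.
  move=> h; rewrite ler_distl; apply/andP; split.
    apply: lb_le_inf; first by exists (pfeval j psi a + r), psi, r.
    by move=> _ [psi' [r' [h' ->]]]; exact: key.
  apply: ge_inf; last by exists psi, r.
  by exists (pfeval j psi a - r) => _ [psi' [r' [h' ->]]]; exact: key.
have ex : exists r : R, forall e : R, 0 < e -> exists phi : pformula A G,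
     (forall b, `|P b - pfeval (elemext_id M) phi b| <= e) /\
     `|r - pfeval j phi a| <= e.
  by exists (inf S) => r r0; have [psi h] := dP r r0; exists psi; split=> //; exact: infP.
have := getPex ex; rewrite -/(predext j A P a) => /= hr.
apply/ler_addgt0Pr => d d0; have d2 : 0 < d / 2 by rewrite divr_gt0.
have [psi [h h']] := hr _ d2.
apply: le_trans (ler_distD (pfeval j psi a) _ _) _.
have : `|pfeval j psi a - pfeval j phi a| <= d / 2 + e.
  apply: pformula_transfer => b; apply: le_trans (ler_distD (P b) _ _) _.
  by rewrite lerD // distrC.
by lra.
Qed.

Lemma predext_lip P Q (e : R) a : Def A P -> Def A Q ->
  (forall b, `|P b - Q b| <= e) -> `|predext j A P a - predext j A Q a| <= e.
Proof.
move=> dP dQ h; apply/ler_addgt0Pr => d d0.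
have d2 : 0 < d / 2 by rewrite divr_gt0.
have [phi hphi] := dP _ d2.
have h1 := predext_approx a dP hphi.
have h2 : `|predext j A Q a - pfeval j phi a| <= e + d / 2.
  apply: predext_approx => // b; apply: le_trans (ler_distD (P b) _ _) _.
  by rewrite lerD // distrC.
apply: le_trans (ler_distD (pfeval j phi a) _ _) _.
by rewrite [X in _ + X]distrC; lra.
Qed.

Lemma predext_emb P (a : env M G) : Def A P ->
  predext j A P (fun i => emb j (a i)) = P a.
Proof.
move=> dP; apply/eqP; rewrite -subr_eq0 -normr_le0; apply/ler_addgt0Pr => d d0.
have d2 : 0 < d / 2 by rewrite divr_gt0.
have [phi hphi] := dP _ d2.
have := predext_approx (fun i => emb j (a i)) dP hphi.
rewrite /pfeval -emb_ecat emb_elem => h; have h' := hphi a.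
apply: le_trans (ler_distD (pfeval (elemext_id M) phi a) _ _) _.
by rewrite [X in _ + X]distrC; rewrite /pfeval in h' *; lra.
Qed.

End Approximation.

Lemma predext_id M (A : paramset M) G (P : env M G -> R) a : Def A P ->
  predext (elemext_id M) A P a = P a.
Proof. exact: (predext_emb (elemext_id M)). Qed.

End Predext.

(** * Real formulas in the imaginary expansion *)

Section Translation.
Variables (R : realType) (L : signature).
Notation Leq := (eqsig R L).

(** Translating an L-formula into L^eq does not preserve the context on the nose
under quantifiers: cmap inl (cext G s) and cext (cmap inl G) (inl s) are only
pointwise equal.  The translation therefore carries an assignment of L^eq-terms
to the variables of G, as a substitution does. *)
Definition real_assignment (G : ctx (Sort L)) (G' : ctx (Sort Leq)) :=
  forall i : cvar G, term (L := Leq) G' (inl (csort i)).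

Fixpoint treq (G : ctx (Sort L)) (G' : ctx (Sort Leq)) (sg : real_assignment G G')
    s (t : term G s) : term (L := Leq) G' (inl s) :=
  match t with
  | Var i => sg i
  | App f u => App (L := Leq) (G := G') (f := f) (fun i => treq sg (u i))
  end.

Definition reqext G G' (sg : real_assignment G G') s :
    real_assignment (cext G s) (cext G' (inl s)) :=
  fun i => match i with
  | Some j => tsubst (fun k => Var (L := Leq) (G := cext G' (inl s)) (Some k)) (sg j)
  | None => Var (L := Leq) (G := cext G' (inl s)) None
  end.

Fixpoint freq G (phi : formula R G) :
    forall G' : ctx (Sort Leq), real_assignment G G' -> formula R G' :=
  match phi with
  | FPred _ P t => fun G' sg =>
      FPred R (L := Leq) (G := G') (P := inl P) (fun i => treq sg (t i))
  | FDist _ s t u => fun _ sg => FDist R (treq sg t) (treq sg u)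
  | FConn _ n c psi => fun _ sg => FConn c (fun i => freq (psi i) sg)
  | FSup _ s psi => fun _ sg => FSup (freq psi (reqext sg (s := s)))
  | FInf _ s psi => fun _ sg => FInf (freq psi (reqext sg (s := s)))
  end.

Lemma teval_treq (N : structure R Leq) G G' (sg : real_assignment G G') s (t : term G s)
    (rho : env N G') :
  teval rho (treq sg t) = teval (M := reduct N) (fun i => teval rho (sg i)) t.
Proof.
elim: t => [//|f u ih] /=; congr (@fint _ _ N f).
by apply: functional_extensionality_dep => i; exact: ih.
Qed.

Lemma feval_freq (N : structure R Leq) G (phi : formula R G) G'
    (sg : real_assignment G G') (rho : env N G') :
  feval (freq phi sg) rho = feval (M := reduct N) phi (fun i => teval rho (sg i)).
Proof.
have eextE G1 G2 s (th : real_assignment G1 G2) (r : env N G2) (a : N (inl s)) :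
    (fun i => teval (eext r a) (reqext th i)) =
    eext (M := reduct N) (fun i => teval r (th i)) a.
  by apply: functional_extensionality_dep => -[j|] //=; rewrite teval_tsubst.
elim: phi G' sg rho => [{}G P t|{}G s t u|{}G n c psi ih|{}G s psi ih|{}G s psi ih]
  G' sg rho /=.
- congr (@pint _ _ N (inl P)); apply: functional_extensionality_dep => i.
  exact: teval_treq.
- by rewrite !teval_treq.
- by congr (c _); apply/rowP => i; rewrite !mxE.
- by congr (sup _); apply: eq_imagel => a _; rewrite ih eextE.
- by congr (inf _); apply: eq_imagel => a _; rewrite ih eextE.
Qed.

Variable M : structure R L.

Lemma teval_reduct G s (t : term G s) (rho : env M G) :
  teval (M := reduct (eqstr M)) rho t = teval rho t.
Proof.
elim: t => [//|f u ih] /=; congr (@fint _ _ M f).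
by apply: functional_extensionality_dep => i; exact: ih.
Qed.

(** The reduct of M^eq to L has the carriers and symbols of M but is not
convertible to it as a record. *)
Lemma feval_reduct G (phi : formula R G) (rho : env M G) :
  feval (M := reduct (eqstr M)) phi rho = feval phi rho.
Proof.
elim: phi rho => [{}G P t|{}G s t u|{}G n c psi ih|{}G s psi ih|{}G s psi ih] rho /=.
- congr (@pint _ _ M P); apply: functional_extensionality_dep => i.
  exact: teval_reduct.
- by rewrite !teval_reduct.
- by congr (c _); apply/rowP => i; rewrite !mxE.
- by congr (sup _); apply: eq_imagel => a _; rewrite ih.
- by congr (inf _); apply: eq_imagel => a _; rewrite ih.
Qed.

Lemma deval_eqstr X Y (psi : formula R (ccat X Y)) (x : env M X) (y : env M Y) :
  deval (N := eqstr M) psi x y = feval psi (ecat x y).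
Proof. exact: feval_reduct. Qed.

Lemma deval01 (N : structure R Leq) X Y (psi : formula R (ccat X Y))
    (x : env N (rctx R X)) (y : env N (rctx R Y)) : 0 <= deval psi x y <= 1.
Proof. exact: feval01. Qed.

Lemma deval_swap (N : structure R Leq) X Y (psi : formula R (ccat X Y))
    (x : env N (rctx R X)) (y : env N (rctx R Y)) :
  deval (fsubst psi sswap) y x = deval psi x y.
Proof.
rewrite /deval feval_fsubst; congr (feval (M := reduct N) psi _).
by apply: functional_extensionality_dep => -[].
Qed.

End Translation.

(** * Canonical parameters of a totally bounded formula *)

Section CanonicalParameters.
Variables (R : realType) (L : signature) (M : structure R L).
Variables (X Y : ctx (Sort L)) (psi : formula R (ccat X Y)).
Notation Leq := (eqsig R L).
Notation Meq := (eqstr M).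

(** A constant sequence of formulas: the forced limit at a constant sequence of
parameters is then the instance of psi itself, at the cost of further imaginary
elements given by forced limits of varying instances. *)
Definition imsort_of : imsort R L := ImSort (im_y := fun=> Y) (fun=> psi).

Definition instance_fun (b : env M Y) (x : env M X) : R := feval psi (ecat x b).

Lemma canonical_param_subproof (b : env M Y) :
  (forall x, 0 <= instance_fun b x <= 1) /\
  forall e : R, 0 < e -> exists c : forall n, env M (im_y imsort_of n),
    forall x, `|instance_fun b x -
      flim (fun n => feval (im_f imsort_of n) (ecat x (c n)))| <= e.
Proof.
split=> [x|e e0]; first exact: feval01.
exists (fun=> b) => x.
by rewrite [flim _](flim_cst (instance_fun b x)) subrr normr0 ltW.
Qed.

Definition canonical_param (b : env M Y) : Meq (inr imsort_of) :=
  exist _ (instance_fun b) (canonical_param_subproof b) : imag M imsort_of.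

Definition imargs (N : structure R Leq) (x : env N (rctx R X)) (c : N (inr imsort_of)) :
    forall i : cvar (parity (s := Leq) (inr imsort_of)), N (csort i) :=
  fun i => match i with Some k => x k | None => c end.

Definition imeval (N : structure R Leq) (x : env N (rctx R X)) (c : N (inr imsort_of)) : R :=
  @pint R Leq N (inr imsort_of) (imargs x c).

Definition imatom (H : ctx (Sort Leq))
    (t : term (L := Leq) (ccat (rctx R X) H) (inr imsort_of)) : formula R (L := Leq) (ccat (rctx R X) H) :=
  FPred R (L := Leq) (P := inr imsort_of)
    (fun i => match i return term (L := Leq) (ccat (rctx R X) H)
        (csort (c := parity (s := Leq) (inr imsort_of)) i) with
     | Some k => Var (L := Leq) (G := ccat (rctx R X) H) (inl k)
     | None => t
     end).

Lemma imatomE (N : structure R Leq) H t (x : env N (rctx R X)) (h : env N H) :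
  feval (@imatom H t) (ecat x h) = imeval x (teval (ecat x h) t).
Proof.
rewrite /imeval /=; congr (@pint _ _ N (inr imsort_of)).
by apply: functional_extensionality_dep => -[].
Qed.

(** In N, the canonical parameter of psi(.; b) still encodes psi(.; b): this holds
at all points of M, hence at all points of N by transfer. *)
Lemma imeval_canonical (N : structure R Leq) (j : elemext Meq N)
    (b : env Meq (rctx R Y)) (x : env N (rctx R X)) :
  imeval x (emb j (canonical_param b)) = deval psi x (fun i => emb j (b i)).
Proof.
apply/eqP; rewrite -subr_eq0 -normr_le0.
pose H := ccat (c1 (inr imsort_of : Sort Leq)) (rctx R Y).
pose m : env Meq H := ecat (fun _ : cvar (c1 _) => canonical_param b) b.
pose phi1 := @imatom H (Var (L := Leq) (G := ccat (rctx R X) H) (inr (inl tt))).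
pose phi2 := freq psi (fun i => match i with
  | inl k => Var (L := Leq) (G := ccat (rctx R X) H) (inl k)
  | inr k => Var (L := Leq) (G := ccat (rctx R X) H) (inr (inr k)) end).
have phi2E (K : structure R Leq) (h : env K H) (y : env K (rctx R X)) :
    feval phi2 (ecat y h) = deval psi y (fun i => h (inr i)).
  rewrite feval_freq /deval; congr (feval (M := reduct K) psi _).
  by apply: functional_extensionality_dep => -[].
have := transfer_dist (phi := phi1) (psi := phi2) (m := m) (r := 0) j _ x.
rewrite imatomE phi2E; apply=> y.
by rewrite imatomE phi2E deval_eqstr subrr normr0.
Qed.

Section Finite.
Hypothesis psi_tb : totally_bounded (fun x y => feval (M := M) psi (ecat x y)).

(** An imaginary element is close to the forced limit of instances psi(.; b_n),
and only b_0, ..., b_N matter; their colours give a finite colouring of the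
imaginary sort. *)
Lemma imag_finite_net (e : R) : 0 < e ->
  exists n (c : 'I_n -> imag M imsort_of), forall f, exists i, imdist (c i) f <= e.
Proof.
move=> e0; have e4 : 0 < e / 4 by rewrite divr_gt0.
have [F [col hcol]] := psi_tb e4.
have [N hN] : exists N, 2 ^- N < e / 8.
  have e8 : 0 < e / 8 by rewrite divr_gt0.
  have [N _ /(_ N (leqnn _)) /= hN] := near_infty_natSinv_expn_lt (PosNum e8).
  by exists N; move: hN; rewrite /= div1r.
have e16 : 0 < e / 16 by rewrite divr_gt0.
pose seq_of (f : imag M imsort_of) := sval (cid ((proj2_sig f).2 _ e16)).
(* a chosen sequence of parameters whose forced limit is close to f *)
have seqP f x : `|sval f x - flim (fun n => feval psi (ecat x (seq_of f n)))| <= e / 16.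
  exact: (svalP (cid ((proj2_sig f).2 _ e16)) x).
pose imcol f := [ffun k : 'I_N.+1 => col (seq_of f k)].
have [n [c hc]] := coloring_net imcol.
exists n, c => f; have [i hi] := hc f; exists i.
apply: le_imdist => [|x]; first exact: ltW.
pose a g k := feval psi (ecat x (seq_of g k)).
have h1 := seqP (c i) x; have h2 := seqP f x.
have h3 := flim_dist (a (c i)) N; have h4 := flim_dist (a f) N.
have h5 : `|flim_seq (a (c i)) N - flim_seq (a f) N| <= e / 4.
  apply: flim_seq_close => k kN; apply: hcol.
  by move/ffunP/(_ (Ordinal (kN : (k < N.+1)%N))): hi; rewrite !ffunE.
rewrite -/(a _) in h1 h2; move: h1 h2 h3 h4 h5 hN.
rewrite !ler_norml => /andP[? ?] /andP[? ?] /andP[? ?] /andP[? ?] /andP[? ?] ?.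
by apply/andP; split; lra.
Qed.

(** A finite net of the whole imaginary sort in M remains a net in N, so it covers
in particular the conjugates of c. *)
Lemma imag_acleq (A : paramset M) (c : imag M imsort_of) :
  acleq A (c : Meq (inr imsort_of)).
Proof.
move=> N j e e0; have e2 : 0 < e / 2 by rewrite divr_gt0.
have [n [d hd]] := imag_finite_net e2.
pose H : ctx (Sort Leq) := Ctx (fun _ : 'I_n => inr imsort_of).
pose cp := conn_prod n (ltW e2).
pose phi : formula R (L := Leq) (ccat (c1 (inr imsort_of)) H) :=
  FConn (sval cp) (fun i : 'I_n => FDist R
    (Var (L := Leq) (G := ccat (c1 (inr imsort_of)) H) (inr i))
    (Var (L := Leq) (G := ccat (c1 (inr imsort_of)) H) (inl tt))).
have phiE (K : structure R Leq) (h : env K H) (a : env K (c1 (inr imsort_of))) :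
    feval phi (ecat a h) = \prod_(i < n) Num.max 0 (dist (h i) (a tt) - e / 2).
  by rewrite /= (svalP cp); apply: eq_bigr => i _; rewrite mxE.
exists n, (fun i => emb j (d i : Meq (inr imsort_of))) => a' _.
have := transfer_le (phi := phi) (m := d : env Meq H) (r := 0) j _ (fun=> a').
rewrite phiE => hle; apply: contrapT => hno.
suff : 0 < \prod_(i < n)
    Num.max 0 (dist (emb j (d i : Meq (inr imsort_of))) a' - e / 2).
  rewrite ltNge hle // => a; rewrite phiE; have [i hi] := hd (a tt).
  by rewrite (bigD1 i) //= max_l ?mul0r // subr_le0.
apply: prodr_gt0 => i _; rewrite lt_max; apply/orP; right; rewrite subr_gt0.
by apply: contra_notT hno => h; exists i; rewrite ltNge; apply: contra h => ?; lra.
Qed.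

End Finite.

Section WeightedSums.
Variables (E : paramset Meq) (n : nat) (w : 'I_n -> R) (b : 'I_n -> env Meq (rctx R Y)).
Hypothesis w0 : forall i, 0 <= w i.
Hypothesis w1 : \sum_(i < n) w i <= 1.
Hypothesis bE : forall i, E (canonical_param (b i)).

Let H : ctx (Sort Leq) := Ctx (fun _ : 'I_n => inr imsort_of).

Definition wsum_pformula : pformula E (rctx R X) :=
  @PFormula R Leq Meq E (rctx R X) H
    (FConn (sval (conn_wsum w0 w1)) (fun i =>
       @imatom H (Var (L := Leq) (G := ccat (rctx R X) H) (inr i))))
    (fun i => canonical_param (b i)) bE.

Lemma wsum_pformulaE (N : structure R Leq) (j : elemext Meq N)
    (x : env N (rctx R X)) :
  pfeval j wsum_pformula x =
  \sum_(i < n) w i * deval psi x (fun k => emb j (b i k)).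
Proof.
rewrite /pfeval [LHS](svalP (conn_wsum w0 w1)); apply: eq_bigr => i _.
rewrite mxE -imeval_canonical; congr (_ * _).
exact: (@imatomE N H _ x (fun i => emb j (canonical_param (b i)))).
Qed.

End WeightedSums.

End CanonicalParameters.

(** * Spaces of types *)

Section TypeSpaces.
Variables (R : realType) (L : signature) (M : structure R L) (G : ctx (Sort L)).
Implicit Types Phi Psi : set (env M G -> R).

Lemma type_eval_continuous Phi (chi : Phi) : continuous (fun p : types Phi => \val p chi).
Proof.
move=> p; apply: (@continuous_comp _ _ _ (fun q : types Phi => \val q)
  (fun f : {ptws Phi -> R} => f chi)).
  exact: initial_continuous.
exact: (@proj_continuous Phi (fun=> R) chi).
Qed.

Lemma restr_continuous Phi Psi (s : Psi `<=` Phi) : continuous (restr s).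
Proof.
apply: continuous_comp_initial => p.
have FF : Filter (nbhs p) := nbhs_filter p.
apply: (iffRL (@cvg_sup _ _ _ _ _ (fmap_filter (set_val \o restr s) FF))) => chi.
apply: (@continuous_comp_initial _ _ _ (fun f : {ptws Psi -> R} => f chi)
  (fun q : types Phi => \val (restr s q))).
exact: (type_eval_continuous (chi := Defs.incl s chi)).
Qed.

Lemma type_finsat Phi (p : types Phi) (I : finType) (chi : I -> Phi) (e : R) : 0 < e ->
  exists a, forall i, `|\val (chi i) a - \val p (chi i)| < e.
Proof.
move=> e0; have [a ha] := set_mem (valP p) _ (fun k : 'I_#|I| => chi (enum_val k)) e e0.
by exists a => i; have := ha (enum_rank i); rewrite enum_rankK.
Qed.

(** A point of M that realizes p approximately at chi and chi' compares the two
values. *)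
Lemma type_lip Phi (p : types Phi) (chi chi' : Phi) (e : R) :
  (forall a, `|\val chi a - \val chi' a| <= e) -> `|\val p chi - \val p chi'| <= e.
Proof.
move=> h; apply/ler_addgt0Pr => d d0; have d2 : 0 < d / 2 by rewrite divr_gt0.
have [a ha] := type_finsat p (fun b : bool => if b then chi else chi') d2.
have h1 := ha true; have h2 := ha false; have h3 := h a.
move: h1 h2 h3; rewrite !ltr_norml !ler_norml.
by move=> /andP[? ?] /andP[? ?] /andP[? ?]; apply/andP; split; lra.
Qed.

End TypeSpaces.

(** * Good definitions and barycenters *)

Section Barycenter.
Variables (R : realType) (L : signature) (M : structure R L) (A : paramset M).
Variables (Gu Gv : ctx (Sort L)) (delta : formula R (ccat Gu Gv)).
Notation Leq := (eqsig R L).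
Notation Meq := (eqstr M).
Notation E := (acleq A).
Notation U := (env Meq (rctx R Gu)).
Notation V := (env Meq (rctx R Gv)).

Hypothesis delta_tb : totally_bounded
  (fun (a : env M Gu) (b : env M Gv) => feval delta (ecat a b)).

Lemma deval_tb : totally_bounded (fun (a : U) (b : V) => deval delta a b).
Proof.
move=> e e0; have [F [col hcol]] := delta_tb e0.
by exists F, col => b b' hb a; rewrite !deval_eqstr; exact: hcol.
Qed.

Lemma deval_tb' : totally_bounded (fun (b : V) (a : U) => deval delta a b).
Proof. by apply: totally_bounded_swap deval_tb => a b; exact: deval01. Qed.

Lemma swap_tb : totally_bounded
  (fun (b : env M Gv) (a : env M Gu) => feval (fsubst delta sswap) (ecat b a)).
Proof.
move=> e e0; have [F [col hcol]] := deval_tb' e0.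
exists F, col => a a' ha b.
by rewrite -!(deval_eqstr (fsubst delta sswap)) !deval_swap; exact: hcol.
Qed.

Section RowCombination.
Variables (n : nat) (w : 'I_n -> R) (a : 'I_n -> U).
Hypotheses (w0 : forall i, 0 <= w i) (w1 : \sum_(i < n) w i <= 1).

Definition row_comb : pformula E (rctx R Gv) :=
  @wsum_pformula R L M Gv Gu (fsubst delta sswap) E n w a w0 w1
    (fun i => imag_acleq swap_tb A (canonical_param (fsubst delta sswap) (a i))).

Lemma row_combE (N : structure R Leq) (j : elemext Meq N) (b : env N (rctx R Gv)) :
  pfeval j row_comb b = \sum_(i < n) w i * deval delta (fun k => emb j (a i k)) b.
Proof. by rewrite wsum_pformulaE; apply: eq_bigr => i _; rewrite deval_swap. Qed.

End RowCombination.

Lemma sum1_le1 : \sum_(i < 1) (1 : R) <= 1.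
Proof. by rewrite big_ord1. Qed.

Definition row_formula (a : U) : pformula E (rctx R Gv) :=
  row_comb (fun=> a) (fun=> ler01) sum1_le1.

Lemma row_formulaE (N : structure R Leq) (j : elemext Meq N) (a : U) (b : env N (rctx R Gv)) :
  pfeval j (row_formula a) b = deval delta (fun k => emb j (a k)) b.
Proof. by rewrite row_combE big_ord1 mul1r. Qed.

Definition instance (b : V) : U -> R := fun a => deval delta a b.

(** The canonical parameter of delta(.; b) lies in E = acl^eq even when b does
not. *)
Lemma instance_dDef b : dDefE E delta (instance b).
Proof.
split=> e e0.
  pose phi := @wsum_pformula R L M Gu Gv delta E 1 (fun=> 1) (fun=> b)
    (fun=> ler01) sum1_le1 (fun i => imag_acleq delta_tb A (canonical_param delta b)).
  exists phi => a; rewrite wsum_pformulaE big_ord1 mul1r subrr normr0; exact: ltW.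
exists 1%N, (sval (conn_proj R)), (fun=> b) => a.
by rewrite (svalP (conn_proj R)) mxE subrr normr0 ltW.
Qed.

Definition pinst (b : V) : dDefE E delta := toset (instance_dDef b).

Definition defpred (p : Sdelta E delta) : V -> R := fun b => \val p (pinst b).

Lemma defpred_lip p b b' (e : R) : (forall a, `|deval delta a b - deval delta a b'| <= e) ->
  `|defpred p b - defpred p b'| <= e.
Proof. by move=> h; exact: (@type_lip _ _ _ _ _ p (pinst b) (pinst b') e h). Qed.

(** The values of p at a finite net of instances control its values at all
instances, so one approximate realization a works uniformly in b. *)
Lemma defpred_approx p l (chi : 'I_l -> dDefE E delta) (e : R) : 0 < e ->
  exists a : U, (forall i, `|\val (chi i) a - \val p (chi i)| < e) /\
    forall b, `|deval delta a b - defpred p b| <= e.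
Proof.
move=> e0; have e3 : 0 < e / 3 by rewrite divr_gt0.
have [F [col hcol]] := deval_tb e3; have [n [c hc]] := coloring_net col.
(* a has to meet the l given constraints and the values of p at the net *)
have [a ha] := type_finsat p (fun i : 'I_l + 'I_n =>
  match i with inl i => chi i | inr i => pinst (c i) end) e3.
exists a; split=> [i|b]; first by apply: lt_trans (ha (inl i)) _; lra.
have [i hi] := hc b; have h1 := hcol _ _ hi; have h2 := defpred_lip p h1.
have h3 : `|deval delta a (c i) - defpred p (c i)| < e / 3 := ha (inr i).
move: (h1 a) h3 h2; rewrite !ler_norml ltr_norml.
by move=> /andP[? ?] /andP[? ?] /andP[? ?]; apply/andP; split; lra.
Qed.

Lemma defpred_near_row p (e : R) : 0 < e ->
  exists a : U, forall b, `|deval delta a b - defpred p b| <= e.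
Proof.
move=> e0; have [] := defpred_approx p (l := 0) (fun i => match notF (ltn_ord i) with end) e0.
by move=> a [_ ha]; exists a.
Qed.

Lemma defpred_Def p : Def E (defpred p).
Proof.
move=> e e0; have [a ha] := defpred_near_row p e0.
by exists (row_formula a) => b; rewrite row_formulaE distrC; exact: ha.
Qed.

Lemma predext_defpred_row (N : structure R Leq) (j : elemext Meq N) p a (e : R) :
  (forall b, `|defpred p b - deval delta a b| <= e) ->
  forall b, `|predext j E (defpred p) b - deval delta (fun k => emb j (a k)) b| <= e.
Proof.
move=> h b; rewrite -row_formulaE; apply: predext_approx; first exact: defpred_Def.
by move=> c; rewrite row_formulaE; exact: h.
Qed.

(** The image in N of an approximate realization in M is the required witness. *)
Lemma defpred_good p : good_definition p (defpred p).
Proof.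
split=> [|N j k b l chi e e0]; first exact: defpred_Def.
have e2 : 0 < e / 2 by rewrite divr_gt0.
have [a [hchi ha]] := defpred_approx p chi e2.
exists (fun i => emb j (a i)); split=> i.
  have h c : `|defpred p c - deval delta a c| <= e / 2 by rewrite distrC.
  by rewrite distrC; apply: le_lt_trans (predext_defpred_row j h (b i)) _; lra.
rewrite predext_emb; first by apply: lt_trans (hchi i) _; lra.
by case: (set_mem (valP (chi i))).
Qed.

(** Consistency inside M itself, against the predicate delta(.; b) which is in the
domain of p, forces the value at b. *)
Lemma good_definition_unique p P : good_definition p P -> P = defpred p.
Proof.
move=> [dP hP]; apply/funext => b; apply/eqP; rewrite -subr_eq0 -normr_le0.
apply/ler_addgt0Pr => e e0; have e2 : 0 < e / 2 by rewrite divr_gt0.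
(* N = M, with the single instance delta(.; b) on both sides *)
have [a [h1 h2]] := hP Meq (elemext_id _) 1%N (fun=> b) 1%N (fun=> pinst b) _ e2.
move: (h1 ord0) (h2 ord0) => {h1 h2}.
rewrite (predext_id _ dP) (@predext_id _ _ _ _ _ (instance b)); last first.
  by case: (instance_dDef b).
rewrite -/(defpred p b) /instance !ltr_norml ler_norml => /andP[? ?] /andP[? ?].
by apply/andP; split; lra.
Qed.

(** The logic topology controls the values of d_p at a finite net, hence d_p in
uniform norm. *)
Lemma defpred_near p (e : R) : 0 < e ->
  \forall q \near p, forall b, `|defpred p b - defpred q b| <= e.
Proof.
move=> e0; have e3 : 0 < e / 3 by rewrite divr_gt0.
have [F [col hcol]] := deval_tb e3; have [n [c hc]] := coloring_net col.
have : \forall q \near p, forall i : 'I_n, `|defpred p (c i) - defpred q (c i)| < e / 3.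
  apply: (@filter_forall _ _ (fun i q => `|defpred p (c i) - defpred q (c i)| < e / 3) _
    (nbhs_filter p)) => i.
  by have /cvgrPdist_lt/(_ _ e3) := @type_eval_continuous _ _ _ _ _ (pinst (c i)) p.
apply: filterS => q hq b; have [i hi] := hc b; have h := hcol _ _ hi.
move: (hq i) (defpred_lip p h) (defpred_lip q h); rewrite !ler_norml ltr_norml.
by move=> /andP[? ?] /andP[? ?] /andP[? ?]; apply/andP; split; lra.
Qed.

Lemma predext_defpred_continuous (N : structure R Leq) (j : elemext Meq N) b :
  continuous (fun p : Sdelta E delta => predext j E (defpred p) b).
Proof.
move=> p; apply: (iffRL (@cvgrPdist_le _ _ _ _ (nbhs_filter p) _ _)) => e e0.
apply: filterS (defpred_near p e0) => q hq.
by apply: predext_lip => //; exact: defpred_Def.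
Qed.

(** The cells are obtained from finitely many closed sets that cover the type
space, by sending a type to the first of them that contains it. *)
Lemma row_cells (p0 : Sdelta E delta) (e : R) : 0 < e ->
  exists n (a : 'I_n -> U) (g : Borel p0 -> 'I_n),
    (forall i, measurable (g @^-1` [set i])) /\
    forall p b, `|defpred p b - deval delta (a (g p)) b| <= e.
Proof.
move=> e0; have e2 : 0 < e / 2 by rewrite divr_gt0.
have [F [col hcol]] := deval_tb' e2; have [n [a ha]] := coloring_net col.
pose C (i : 'I_n) : set (Borel p0) := [set p | forall b, `|defpred p b - deval delta (a i) b| <= e].
have mC i : measurable (C i).
  apply: closed_Borel.
  rewrite (_ : C i = \bigcap_b [set p | `|defpred p b - deval delta (a i) b| <= e]); last first.
    by apply/seteqP; split=> [p Cp b _|p Cp b]; [exact: Cp | exact: Cp].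
  apply: closed_bigI => b _.
  have cf : continuous (fun p : Sdelta E delta => `|defpred p b - deval delta (a i) b|).
    move=> p; apply: (@continuous_comp _ _ _
      (fun p => defpred p b - deval delta (a i) b) Num.norm).
      by apply: continuousB; [exact: type_eval_continuous | exact: cst_continuous].
    exact: norm_continuous.
  exact: (iffLR (continuous_closedP _) cf _ (@closed_le R e)).
have exC p : exists i, C i p.
  have [a' ha'] := defpred_near_row p e2.
  have [i hi] := ha a'; exists i => b; move: (hcol _ _ hi b) (ha' b).
  by rewrite !ler_norml => /andP[? ?] /andP[? ?]; apply/andP; split; lra.
(* the index of the first closed set that contains p *)
have exg p : exists i, C i p /\ forall k : 'I_n, (k < i)%N -> ~ C k p.
  have [i0 Ci0] := exC p.
  have [i /asboolP Ci hi] := arg_minnP (fun i : 'I_n => i : nat)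
    (asboolT Ci0 : (fun i => `[< C i p >]) i0).
  by exists i; split=> // k ki Ck; have := hi k (asboolT Ck); rewrite leqNgt ki.
pose g (p : Borel p0) : 'I_n := sval (cid (exg p)).
have gP p : C (g p) p /\ forall k : 'I_n, (k < g p)%N -> ~ C k p := svalP (cid (exg p)).
exists n, a, g; split=> [i|p b]; last exact: (gP p).1.
rewrite (_ : g @^-1` [set i] = C i `&` \bigcap_(k in [set k : 'I_n | (k < i)%N]) ~` C k).
  by apply: measurableI => //; apply: fin_bigcap_measurable => // k _; exact: measurableC.
apply/seteqP; split=> [p /= <-|p [Ci hi] /=]; first exact: gP p.
have [Cg hg] := gP p; apply/val_inj/eqP; rewrite eqn_leq; apply/andP; split.
  by rewrite leqNgt; apply/negP => /hg.
by rewrite leqNgt; apply/negP => /hi.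
Qed.

Section Integral.
Variables (p0 : Sdelta E delta) (mu : probability (Borel p0) R).

Lemma predext_defpred_bound (N : structure R Leq) (j : elemext Meq N) b p :
  `|predext j E (defpred p) b| <= 2.
Proof.
have [a ha] := defpred_near_row p ltr01.
have h c : `|defpred p c - deval delta a c| <= 1 by rewrite distrC.
have := deval01 delta (fun k => emb j (a k)) b; have := predext_defpred_row j h b.
by rewrite !ler_norml => /andP[? ?] /andP[? ?]; apply/andP; split; lra.
Qed.

Lemma predext_defpred_integrable (N : structure R Leq) (j : elemext Meq N) b :
  mu.-integrable setT (fun p : Borel p0 => (predext j E (defpred p) b)%:E).
Proof.
apply: (@probability_bounded_integrable _ _ _ mu (fun p => predext j E (defpred p) b) _ _
  (predext_defpred_bound j b)).
exact: continuous_Borel_real (@predext_defpred_continuous N j b).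
Qed.

Definition mean_defpred (b : V) : R := \int[mu]_p defpred p b.

(** A single formula over E, a convex combination of predicates delta(a_i; .),
approximates the integral in all elementary extensions at once. *)
Lemma mean_row_comb (e : R) : 0 < e ->
  exists phi : pformula E (rctx R Gv), forall (N : structure R Leq) (j : elemext Meq N) b,
    `|\int[mu]_p predext j E (defpred p) b - pfeval j phi b| <= e.
Proof.
move=> e0; have [n [a [g [mg hg]]]] := row_cells p0 e0.
have w1 : \sum_(i < n) cell_weight mu g i <= 1 by rewrite cell_weight_sum.
exists (row_comb a (cell_weight_ge0 mu g) w1) => N j b; rewrite row_combE.
apply: (@integral_approx _ _ _ mu _ _ mg _ (fun i => deval delta (fun k => emb j (a i k)) b)).
  exact: continuous_Borel_real (@predext_defpred_continuous N j b).
by move=> p; apply: predext_defpred_row; exact: hg.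
Qed.

Lemma mean_Def : Def E mean_defpred.
Proof.
move=> e e0; have [phi hphi] := mean_row_comb e0; exists phi => b.
rewrite /mean_defpred (_ : \int[mu]_p defpred p b =
    \int[mu]_p predext (elemext_id Meq) E (defpred p) b) //.
by apply: eq_Rintegral => p _; rewrite predext_id //; exact: defpred_Def.
Qed.

Lemma predext_mean (N : structure R Leq) (j : elemext Meq N) b :
  predext j E mean_defpred b = \int[mu]_p predext j E (defpred p) b.
Proof.
apply/eqP; rewrite -subr_eq0 -normr_le0; apply/ler_addgt0Pr => e e0; rewrite add0r.
have e2 : 0 < e / 2 by rewrite divr_gt0.
have [phi hphi] := mean_row_comb e2.
have h : `|predext j E mean_defpred b - pfeval j phi b| <= e / 2.
  apply: predext_approx; first exact: mean_Def.
  move=> c; have := hphi _ (elemext_id Meq) c; congr (`|_ - _| <= _).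
  by apply: eq_Rintegral => p _; rewrite predext_id //; exact: defpred_Def.
apply: le_trans (ler_distD (pfeval j phi b) _ _) _.
by rewrite (splitr e) lerD // distrC.
Qed.

Lemma barycenter_mean : barycenter mu mean_defpred.
Proof.
split; first exact: mean_Def.
exists defpred; split; first exact: defpred_good.
move=> N j b; split; first exact: predext_defpred_integrable.
rewrite predext_mean /Rintegral fineK //.
exact: integrable_fin_num (predext_defpred_integrable j b).
Qed.

Lemma barycenter_unique B : barycenter mu B -> B = mean_defpred.
Proof.
move=> [dB [d [hd hB]]].
have dE : d = defpred by apply/funext => p; exact: good_definition_unique.
apply/funext => b; have [_] := hB _ (elemext_id Meq) b.
rewrite predext_id // dE => h; rewrite /mean_defpred /Rintegral.
rewrite (_ : (\int[mu]_p (defpred p b)%:E = (B b)%:E)%E) //.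
by rewrite h; apply: eq_integral => p _; rewrite predext_id //; exact: defpred_Def.
Qed.

End Integral.

End Barycenter.

(** * The formulas of Delta_U *)

Section DeltaU.
Variables (R : realType) (S : setting R) (C0 : forall n, set (connective R n)).

(** The colouring only looks at the point of the compact sort Y_U; a colouring of
the h's then comes from [totally_bounded_swap]. *)
Lemma Theta_totally_bounded :
  totally_bounded (fun (a : env (Mgl S) (c1 (SH1 _))) (b : env (Mgl S) (c1 (SY _))) =>
    feval (M := Mgl S) (Theta_formula R (pt S) (dset S)) (ecat a b)).
Proof.
move=> e e0; have [r r0 hr] := Theta_ucont S e0.
have [F [col hcol]] := compact_coloring
  (T := one_point_compactification {n : nat & exh S n})
  one_point_compactification_compact (@met_compat _ S (SY _))
  (@met_sym _ S (SY _)) (@met_tri _ S (SY _)) r0.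
exists F, (fun b => col (b tt)) => b b' hb a.
by apply/ltW/hr; [rewrite met_refl | exact: hcol].
Qed.

Lemma DeltaU_totally_bounded (Gu Gv : ctx (Sort (Lgl S))) (delta : formula R (ccat Gu Gv)) :
  DeltaU C0 delta ->
  totally_bounded (fun (a : env (Mgl S) Gu) (b : env (Mgl S) Gv) => feval delta (ecat a b)).
Proof.
elim=> {Gu Gv delta}.
- exact: Theta_totally_bounded.
- move=> Gu Gv n c phi _ _ ih.
  exact: (totally_bounded_connective c (fun i a b => feval01 (phi i) (ecat a b)) ih).
- move=> Gu Gv Gu' Gv' phi su sv _ ih _ _ e e0.
  have [F [col hcol]] := totally_bounded_comp
    (fun a i => teval a (su i)) (fun b i => teval b (sv i)) ih e0.
  exists F, col => b b' hb a; rewrite !feval_fsubst.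
  have envE (y : env (Mgl S) Gv') :
      (fun i => teval (ecat a y) (scat su sv i)) =
      ecat (fun i => teval a (su i)) (fun i => teval y (sv i)).
    by apply: functional_extensionality_dep => -[i|i] /=; rewrite teval_tsubst.
  by rewrite !envE; exact: hcol.
- move=> Gu Gv phi _ ih e e0.
  have [F [col hcol]] := totally_bounded_swap (fun a b => feval01 phi (ecat a b)) ih e0.
  exists F, col => a a' ha b; rewrite !feval_fsubst.
  have envE (x : env (Mgl S) Gu) : (fun i => teval (ecat b x) (sswap i)) = ecat x b.
    by apply: functional_extensionality_dep => -[].
  by rewrite !envE; exact: hcol.
Qed.

End DeltaU.

Section Pushforward.
Variables (R : realType) (L : signature) (M : structure R L) (E : paramset (eqstr M)).
Variables (Gu Gv : ctx (Sort L)) (delta : formula R (ccat Gu Gv)).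
Variables (q0 : S1 E Gu) (rho : probability (Borel q0) R).

Lemma rdelta_measurable :
  measurable_fun setT (rdelta delta : Borel q0 -> Borel (rdelta delta q0)).
Proof.
apply: (@continuous_Borel _ _ q0 (rdelta delta q0) (rdelta delta)).
exact: restr_continuous.
Qed.

Definition rdelta_mfun : {mfun Borel q0 >-> Borel (rdelta delta q0)} :=
  mfun_Sub (mem_set rdelta_measurable).

(** The integral of a function is studied for bundled probabilities only; as a set
function, this one is convertible to the image of rho by the restriction map. *)
Definition local_measure : probability (Borel (rdelta delta q0)) R :=
  distribution rho rdelta_mfun.

End Pushforward.

Theorem theorem5p7 (R : realType) (S : setting R)
    (C0 : forall n, set (connective R n)) (hC0 : connective_basis C0)
    (Gu Gv : ctx (Sort (Lgl S))) (delta : formula R (ccat Gu Gv))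
    (hdelta : DeltaU C0 delta) :
  (forall (p0 : Sdelta (Egl S) delta) (mu : probability (Borel p0) R),
     regular_measure mu ->
     exists! B : env (eqstr (Mgl S)) (rctx R Gv) -> R, barycenter mu B)
  /\
  (forall (q0 : S1 (Egl S) Gu) (rho : probability (Borel q0) R),
     regular_measure rho ->
     exists! B : env (eqstr (Mgl S)) (rctx R Gv) -> R,
       complete_barycenter delta rho B)
  /\
  (forall (q0 : S1 (Egl S) Gu) (rho rho' : probability (Borel q0) R)
          (B B' : env (eqstr (Mgl S)) (rctx R Gv) -> R),
     regular_measure rho -> regular_measure rho' ->
     (forall A : set (Borel (rdelta delta q0)), measurable A ->
        pushr delta rho A = pushr delta rho' A) ->
     complete_barycenter delta rho B -> complete_barycenter delta rho' B' ->
     B = B')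
  /\
  (forall (q0 : S1 (Egl S) Gu) (mu : probability (Borel (rdelta delta q0)) R)
          (rho rho' : probability (Borel q0) R)
          (B B' : env (eqstr (Mgl S)) (rctx R Gv) -> R),
     regular_measure mu -> regular_measure rho -> regular_measure rho' ->
     complete_lift delta mu rho -> complete_lift delta mu rho' ->
     complete_barycenter delta rho B -> complete_barycenter delta rho' B' ->
     B = B').
Proof.
have tb := DeltaU_totally_bounded hdelta.
have unique (p0 : Sdelta (Egl S) delta) (mu : probability (Borel p0) R) :
    exists! B, barycenter mu B.
  exists (mean_defpred tb mu); split; first exact: barycenter_mean.
  by move=> B hB; rewrite (barycenter_unique tb hB).
have determined (q0 : S1 (Egl S) Gu) (rho rho' : probability (Borel q0) R)
    (B B' : env (eqstr (Mgl S)) (rctx R Gv) -> R) :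
    (forall A, measurable A -> pushr delta rho A = pushr delta rho' A) ->
    complete_barycenter delta rho B -> complete_barycenter delta rho' B' -> B = B'.
  move=> rr' hB hB'.
  rewrite (barycenter_unique (mu := local_measure delta rho) tb hB).
  rewrite (barycenter_unique (mu := local_measure delta rho') tb hB').
  apply/funext => b; rewrite /mean_defpred /Rintegral; congr fine.
  by apply: eq_measure_integral => A mA _; exact: rr'.
do ! split.
- by move=> p0 mu _; exact: unique.
- by move=> q0 rho _; exact: (unique _ (local_measure delta rho)).
- by move=> q0 rho rho' B B' _ _; exact: determined.
- move=> q0 mu rho rho' B B' _ _ _ lrho lrho'; apply: determined => A mA.
  by rewrite lrho // lrho'.
Qed.
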